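(* The category $\Phi\text{-}\mathsf{Sob}$ of $\Phi$-sober spaces and $\Phi$-dense maps is dually equivalent to the category $\Phi\text{-}\mathsf{ATop}$ (in the topological case), respectively $\Phi\text{-}\mathsf{AApp}$ (in the approach case), of $\Phi$-algebraic T$_0$-spaces and right adjoint $\Phi$-cocontinuous continuous, respectively contraction, maps.
   Context: Two parallel cases are treated. Topological case: $\mathsf V=\{\mathrm{false},\mathrm{true}\}=\{0,1\}$, $\otimes=\&$, $k=\mathrm{true}$, $\mathrm{false}\sqsubseteq\mathrm{true}$. Approach case: $\mathsf V=[0,\infty]$, $\otimes=+$, $k=0$, $u\sqsubseteq v$ iff $u\ge v$ numerically (so joins $\bigvee$ in $\mathsf V$ are numerical infima and meets $\bigwedge$ are numerical suprema). A $\mathsf V$-relation $r\colon X\nrightarrow Y$ is a function $X\times Y\to\mathsf V$; composition is $(s\cdot r)(x,z)=\bigvee_y r(x,y)\otimes s(y,z)$; $r^\circ(y,x)=r(x,y)$; $\mathsf V$-relations are ordered pointwise by $\sqsubseteq$; a function is viewed as the $\mathsf V$-relation given by its graph (true $\mapsto k$, false $\mapsto$ bottom of $\mathsf V$). $UX$ is the set of ultrafilters on $X$, $Uf$ the image-ultrafilter map, $e_X(x)$ the principal ultrafilter at $x$, $m_X\colon UUX\to UX$, $m_X(\mathfrak X)=\{A\subseteq X\mid A^\#\in\mathfrak X\}$ with $A^\#=\{\mathfrak x\in UX\mid A\in\mathfrak x\}$. For $r\colon X\nrightarrow Y$, $Ur(\mathfrak x,\mathfrak y)=\bigwedge_{A\in\mathfrak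 x,B\in\mathfrak y}\bigvee_{x\in A,y\in B}r(x,y)$. A space is a pair $(X,a)$ with $a\colon UX\nrightarrow X$, $e_X^\circ\sqsubseteq a$ and $a\cdot Ua\cdot m_X^\circ\sqsubseteq a$; in the topological case these are exactly the topological spaces with their ultrafilter convergence, in the approach case these are the approach spaces. A map $f\colon(X,a)\to(Y,b)$ of spaces is a function with $a(\mathfrak x,x)\sqsubseteq b(Uf(\mathfrak x),f(x))$ (continuous, respectively contraction, map). The categories are $\mathsf{Top}$ and $\mathsf{App}$. Maps are ordered by $f\le g$ iff $k\sqsubseteq b(e_Y(f(x)),g(x))$ for all $x$; $f\cong g$ means $f\le g$ and $g\le f$; $f\dashv g$ means $1\le g\cdot f$ and $f\cdot g\le 1$. The underlying order of $X$ is $x\le y$ iff $k\sqsubseteq a(e_X(x),y)$; $X$ is T$_0$ if this order is anti-symmetric. $X\otimes Y$ is $X\times Y$ with structure $c(\mathfrak w,(x,y))=a(U\pi_1(\mathfrak w),x)\otimes b(U\pi_2(\mathfrak w),y)$. $\mathsf V$ is a space: the Sierpiński space with $\{1\}$ closed, respectively $[0,\infty]$ with $\lambda(\mathfrak u,x)=\max\{x-\xi(\mathfrak u),0\}$ (with $\infty-\infty=0$), $\xi(\mathfrak u)=\sup_{A\in\mathfrak u}\inf A$. A $\mathsf U$-relation $r\colon X\rightharpoonup Y$ is a $\mathsf V$-relation $UX\nrightarrow Y$; Kleisli composition is $s\circ r=s\cdot Ur\cdot m_X^\circ$. A $\mathsf U$-module $\varphi\colon(X,a)\rightharpoonup(Y,b)$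 is a $\mathsf U$-relation with $\varphi\circ a=\varphi$ and $b\circ\varphi=\varphi$; spaces and $\mathsf U$-modules form an ordered category $\mathsf U\text{-}\mathsf{Mod}$ with identities $a$. Each map $f\colon X\to Y$ gives $\mathsf U$-modules $f_*\colon X\rightharpoonup Y$, $f_*(\mathfrak x,y)=b(Uf(\mathfrak x),y)$, and $f^*\colon Y\rightharpoonup X$, $f^*(\mathfrak y,x)=b(\mathfrak y,f(x))$. For $x\in X$, $x^*=a(-,x)\colon X\rightharpoonup 1$, where $1$ is the one-point space. $X^{\mathrm{op}}$ is the space on $UX$ with structure $(\mathfrak X,\mathfrak x)\mapsto(Ua\cdot m_X^\circ)(\mathfrak x,m_X(\mathfrak X))$. $PX$ is the set of $\mathsf U$-modules $\psi\colon X\rightharpoonup 1$ (equivalently, maps $X^{\mathrm{op}}\to\mathsf V$) with the structure of the exponential $\mathsf V^{X^{\mathrm{op}}}$, i.e. the unique one such that for each space $Z$ a function $h\colon Z\to PX$ is a map iff $(z,\mathfrak x)\mapsto h(z)(\mathfrak x)$ is a map $Z\otimes X^{\mathrm{op}}\to\mathsf V$ (this structure exists). Standing assumption: $\Phi\text{-}\mathsf{Mod}$ is a subcategory of $\mathsf U\text{-}\mathsf{Mod}$ (on all spaces) which contains $f^*$ for every map $f$ of spaces, and such that a $\mathsf U$-module $\varphi\colon X\rightharpoonup Y$ is in $\Phi\text{-}\mathsf{Mod}$ iff $y^*\circ\varphi$ is in $\Phi\text{-}\mathsf{Mod}$ for all $y\in Y$. A map $f$ is $\Phi$-dense if $f_*\in\Phi\text{-}\mathsf{Mod}$.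 $\Phi X=\{\psi\in PX\mid\psi\in\Phi\text{-}\mathsf{Mod}\}$ is a subspace of $PX$, and $y_X^\Phi\colon X\to\Phi X$, $x\mapsto x^*$. $X$ is $\Phi$-cocomplete if $y_X^\Phi$ has a left adjoint $\mathrm{Sup}_X^\Phi\colon\Phi X\to X$ in $\mathsf{Top}$/$\mathsf{App}$; a $\Phi$-cocomplete T$_0$-space $X$ is $\Phi$-distributive if $\mathrm{Sup}_X^\Phi$ has a left adjoint in $\mathsf{Top}$/$\mathsf{App}$. A $\Phi$-distributive T$_0$-space is $\Phi$-algebraic if it is isomorphic (in $\mathsf{Top}$/$\mathsf{App}$) to $\Phi Y$ for some space $Y$. A colimit of a map $d\colon B\to X$ weighted by $\psi\colon B\rightharpoonup A$ in $\Phi\text{-}\mathsf{Mod}$ is a map $g\colon A\to X$ such that $g_*$ is the largest $\mathsf U$-module $\gamma\colon A\rightharpoonup X$ with $\gamma\circ\psi\sqsubseteq d_*$. A map $f\colon X\to Y$ is $\Phi$-cocontinuous if it preserves all such colimits which exist in $X$ (for $g$ a colimit of $d$ weighted by $\psi$, $f\cdot g$ is a colimit of $f\cdot d$ weighted by $\psi$); for $X,Y$ $\Phi$-cocomplete this is equivalent to $f\cdot\mathrm{Sup}_X^\Phi\cong\mathrm{Sup}_Y^\Phi\cdot\Phi f$, where $\Phi f(\psi)=\psi\circ f^*$. ''Right adjoint map'' means a map having a left adjoint in $\mathsf{Top}$/$\mathsf{App}$. $\mathrm{map}(\Phi\text{-}\mathsf{Mod})$ is the category of all spaces and those modules in $\Phi\text{-}\mathsf{Mod}$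 which are left adjoint in the ordered category $\Phi\text{-}\mathsf{Mod}$. A T$_0$-space $X$ is $\Phi$-sober if each $\varphi\colon Y\rightharpoonup X$ in $\mathrm{map}(\Phi\text{-}\mathsf{Mod})$ is of the form $\varphi=f_*$ for some (unique) map $f\colon Y\to X$. *)

(* Defs.v *)
From mathcomp Require Import all_boot all_order all_algebra.
From mathcomp Require Import boolp classical_sets filter.
From mathcomp Require Import reals constructive_ereal ereal.
Set Implicit Arguments.
Unset Strict Implicit.
Unset Printing Implicit Defensive.
Import Order.TTheory GRing.Theory Num.Theory.
Local Open Scope classical_set_scope.

Record ultra (T : Type) : Type := Ultra {
  ultra_sets :> set T -> Prop;
  ultraP : UltraFilter ultra_sets }.

Lemma ultra_ext (T : Type) (F G : ultra T) :
  (forall A : set T, F A <-> G A) -> F = G.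
Proof.
case: F G => F FU [G GU] /= FG.
have E : F = G by apply/funext => A; apply/propext; exact: FG.
by move: GU; rewrite -E => GU; congr Ultra.
Qed.

Lemma ultra_of_complement (T : Type) (F : set_system T) :
  ProperFilter F -> (forall A, F A \/ F (~` A)) -> UltraFilter F.
Proof.
move=> FF FC; split=> // G GF FG; rewrite eqEsubset; split=> // A GA.
case: (FC A) => // FnA; exfalso; apply: (@filter_not_empty _ G _).
by rewrite -(setICr A); apply: filterI => //; exact: FG.
Qed.

Lemma ultra_map_subproof (X Y : Type) (f : X -> Y) (F : ultra X) :
  UltraFilter [set B : set Y | F (f @^-1` B)].
Proof.
have FU := ultraP F; apply: ultra_of_complement.
by move=> B; exact: (in_ultra_setVsetC (f @^-1` B) FU).
Qed.

Definition ultra_map (X Y : Type) (f : X -> Y) (F : ultra X) : ultra Y :=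
  Ultra (ultra_map_subproof f F).

Lemma ultra_unit_subproof (X : Type) (x : X) : UltraFilter [set A : set X | A x].
Proof.
apply: ultra_of_complement; last by move=> A; exact: EM.
split=> [[]|]; split=> //=.
by move=> A B AB; exact: AB.
Qed.

Definition ultra_unit (X : Type) (x : X) : ultra X :=
  Ultra (ultra_unit_subproof x).

Definition sharp (X : Type) (A : set X) : set (ultra X) := [set F | F A].

Lemma ultra_mult_subproof (X : Type) (FF : ultra (ultra X)) :
  UltraFilter [set A : set X | FF (sharp A)].
Proof.
have FU := ultraP FF; apply: ultra_of_complement.
  split=> /=.
    have -> : sharp set0 = set0 :> set (ultra X).
      rewrite -subset0 => F; have := ultraP F => ? F0.
      exact: (@filter_not_empty _ (ultra_sets F) _).
    exact: (@filter_not_empty _ (ultra_sets FF) _).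
  split=> /=.
  - apply: filterS (@filterT _ (ultra_sets FF) _) => F _; have := ultraP F => ?.
    exact: (@filterT _ (ultra_sets F) _).
  - move=> A B FA FB.
    apply: filterS (@filterI _ (ultra_sets FF) _ _ _ FA FB) => F [HA HB].
    have HU := ultraP F; exact: (@filterI _ (ultra_sets F) _ A B).
  - move=> A B AB; apply: filterS => F; have HU := ultraP F.
    exact: (@filterS _ (ultra_sets F) _ A B).
move=> A; case: (in_ultra_setVsetC (sharp A) FU) => H; [by left|right].
apply: filterS H => F nFA.
by case: (in_ultra_setVsetC A (ultraP F)).
Qed.

Definition ultra_mult (X : Type) (FF : ultra (ultra X)) : ultra X :=
  Ultra (ultra_mult_subproof FF).

(* Commutative integral quantales; [qconv] is the convergence structure making
   the quantale itself a space. *)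
Record quantale : Type := Quantale {
  qsort :> Type;
  qle : qsort -> qsort -> Prop;
  qsup : set qsort -> qsort;
  qinf : set qsort -> qsort;
  qten : qsort -> qsort -> qsort;
  qone : qsort;
  qconv : ultra qsort -> qsort -> qsort;
  qle_refl : forall u, qle u u;
  qle_trans : forall u v w, qle u v -> qle v w -> qle u w;
  qle_anti : forall u v, qle u v -> qle v u -> u = v;
  qsup_ub : forall (S : set qsort) u, S u -> qle u (qsup S);
  qsup_least : forall (S : set qsort) v,
    (forall u, S u -> qle u v) -> qle (qsup S) v;
  qinf_lb : forall (S : set qsort) u, S u -> qle (qinf S) u;
  qinf_greatest : forall (S : set qsort) v,
    (forall u, S u -> qle v u) -> qle v (qinf S);
  qtenA : forall u v w, qten u (qten v w) = qten (qten u v) w;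
  qtenC : forall u v, qten u v = qten v u;
  qten1 : forall u, qten qone u = u;
  qten_sup : forall u (S : set qsort), qten u (qsup S) = qsup (qten u @` S);
  qone_top : forall u, qle u qone }.

(* The Sierpinski space on [bool] whose closed sets are the empty set,
   [{true}] and the whole space, given by its ultrafilter convergence. *)
Definition sierpinski_open (O : set bool) : Prop :=
  [\/ O = set0, O = [set false] | O = setT].

Definition sierpinski_conv (F : ultra bool) (x : bool) : bool :=
  `[< forall O, sierpinski_open O -> O x -> F O >].

Definition bool_quantale : quantale.
Proof.
refine (@Quantale bool (fun u v => u ==> v)
  (fun S => `[< exists2 u, S u & u >]) (fun S => `[< forall u, S u -> u >])
  andb true sierpinski_conv _ _ _ _ _ _ _ _ _ _ _ _).
- by case.
- by case=> [] [] [].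
- by case=> [] [].
- by move=> S u Su; apply/implyP => u1; apply/asboolP; exists u.
- move=> S v Sv; apply/implyP => /asboolP[u Su u1].
  by have /implyP := Sv _ Su; exact.
- by move=> S u Su; apply/implyP => /asboolP; exact.
- move=> S v Sv; apply/implyP => v1; apply/asboolP => u Su.
  by have /implyP := Sv _ Su; exact.
- exact: andbA.
- exact: andbC.
- by [].
- move=> u S; apply/idP/asboolP.
    by case/andP=> u1 /asboolP[v Sv v1]; exists (u && v); [exists v|rewrite u1].
  case=> _ [v Sv <-] /andP[-> v1] /=; apply/asboolP; by exists v.
- by case.
Defined.

Section Approach.
Variable R : realType.
Local Open Scope ereal_scope.

Definition nnereal : Type := {x : \bar R | 0 <= x}.

Implicit Types (S : set nnereal) (u v w : nnereal).

Definition nn (x : \bar R) (x0 : 0 <= x) : nnereal := exist _ x x0.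

Lemma nnereal_eq u v : sval u = sval v -> u = v.
Proof. by case: u v => x px [y py] /= E; apply: eq_exist. Qed.

Lemma nn_inf_subproof S : 0 <= ereal_inf (sval @` S).
Proof. by apply: le_ereal_inf_tmp => _ [[x x0] _ <-]. Qed.

Definition nn_inf S : nnereal := nn (nn_inf_subproof S).

(* The supremum is taken in [[0, +oo]], so the empty set has supremum [0]. *)
Lemma nn_sup_subproof S : 0 <= maxe 0 (ereal_sup (sval @` S)).
Proof. by rewrite le_max lexx. Qed.

Definition nn_sup S : nnereal := nn (nn_sup_subproof S).

Definition nn_add u v : nnereal :=
  nn (adde_ge0 (svalP u) (svalP v)).

Definition nn_zero : nnereal := nn (lexx 0).

Definition nn_xi (F : ultra nnereal) : nnereal :=
  nn_sup [set nn_inf A | A in F].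

(* In [\bar R] one has [+oo - +oo = -oo], so that the truncated difference
   [maxe (x - y) 0] satisfies the convention that [+oo] minus [+oo] is [0]. *)
Lemma nn_conv_subproof (F : ultra nnereal) u :
  0 <= maxe (sval u - sval (nn_xi F)) 0.
Proof. by rewrite le_max lexx orbT. Qed.

Definition nn_conv (F : ultra nnereal) u : nnereal :=
  nn (nn_conv_subproof F u).

Lemma nn_add_inf u S : nn_add u (nn_inf S) = nn_inf (nn_add u @` S).
Proof.
apply: nnereal_eq => /=; apply/eqP; rewrite eq_le; apply/andP; split.
  apply: le_ereal_inf_tmp => _ [_ [v Sv <-] <-] /=.
  by apply: leeD2l; apply: ereal_inf_lbound; exists v.
case: u => -[r| |] //= r0.
  rewrite addeC -leeBlDr //; apply: le_ereal_inf_tmp => _ [v Sv <-].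
  rewrite leeBlDr // addeC; apply: ereal_inf_lbound.
  by exists (nn_add (nn r0) v) => //; exists v.
by rewrite addye ?leey // -ltNye (lt_le_trans _ (nn_inf_subproof S)) // ltNy0.
Qed.

(* The order is opposite to the numerical one: joins are numerical infima. *)
Definition approach_quantale : quantale.
Proof.
refine (@Quantale nnereal (fun u v => sval v <= sval u) nn_inf nn_sup
  nn_add nn_zero nn_conv _ _ _ _ _ _ _ _ _ _ _ _).
- by move=> u; exact: lexx.
- by move=> u v w vu wv; exact: le_trans wv vu.
- by move=> u v vu uv; apply: nnereal_eq; apply/le_anti/andP.
- by move=> S u Su; apply: ereal_inf_lbound; exists u.
- by move=> S v Sv; apply: le_ereal_inf_tmp => _ [u Su <-]; exact: Sv.
- move=> S u Su /=; rewrite le_max; apply/orP; right.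
  by apply: ereal_sup_ubound; exists u.
- move=> S v Sv /=; rewrite ge_max (svalP v) /=.
  by apply: ge_ereal_sup => _ [u Su <-]; exact: Sv.
- by move=> u v w; apply: nnereal_eq => /=; rewrite addeA.
- by move=> u v; apply: nnereal_eq => /=; rewrite addeC.
- by move=> u; apply: nnereal_eq => /=; rewrite add0e.
- exact: nn_add_inf.
- by case.
Defined.

End Approach.

Definition vrel (V : quantale) (X Y : Type) : Type := X -> Y -> V.

Section Relations.
Variable V : quantale.

Definition rel_le (X Y : Type) (r s : vrel V X Y) : Prop :=
  forall x y, qle (r x y) (s x y).

(* [rcomp s r] is [r] followed by [s]. *)
Definition rcomp (X Y Z : Type) (s : vrel V Y Z) (r : vrel V X Y) : vrel V X Z :=
  fun x z => qsup [set qten (r x y) (s y z) | y in setT].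

Definition rconv (X Y : Type) (r : vrel V X Y) : vrel V Y X := fun y x => r x y.

Definition graph (X Y : Type) (f : X -> Y) : vrel V X Y :=
  fun x y => if `[< f x = y >] then qone V else qsup set0.

Definition ultra_rel (X Y : Type) (r : vrel V X Y) :
    vrel V (ultra X) (ultra Y) :=
  fun F G => qinf [set v | exists A B, [/\ F A, G B &
    v = qsup [set w | exists x y, [/\ A x, B y & w = r x y]]]].

Definition kcomp (X Y Z : Type) (s : vrel V (ultra Y) Z)
    (r : vrel V (ultra X) Y) : vrel V (ultra X) Z :=
  rcomp s (rcomp (ultra_rel r) (rconv (graph (@ultra_mult X)))).

(* Over [bool_quantale] these are the topologies on [X], given by their
   ultrafilter convergence; over [approach_quantale R], the approach structures
   on [X]. *)
Record space_str (X : Type) : Type := SpaceStr {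
  str_conv :> vrel V (ultra X) X;
  str_unit : rel_le (rconv (graph (@ultra_unit X))) str_conv;
  str_assoc : rel_le (rcomp str_conv (rcomp (ultra_rel str_conv)
                        (rconv (graph (@ultra_mult X))))) str_conv }.

Record space : Type := Space {
  pt :> Type;
  str : space_str pt }.

Definition conv (X : space) : vrel V (ultra X) X := str_conv (str X).
Arguments conv : clear implicits.

(* The structures need not satisfy the axioms of a space, so that this applies
   to tensor products, to [X^op] and to [V]. *)
Definition is_map_for (X Y : Type) (a : vrel V (ultra X) X)
    (b : vrel V (ultra Y) Y) (f : X -> Y) : Prop :=
  forall F x, qle (a F x) (b (ultra_map f F) (f x)).

Definition is_map (X Y : space) (f : X -> Y) : Prop :=
  is_map_for (conv X) (conv Y) f.

Definition map_le (X Y : space) (f g : X -> Y) : Prop :=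
  forall x, qle (qone V) (conv Y (ultra_unit (f x)) (g x)).

Definition left_adjoint (X Y : space) (f : X -> Y) (g : Y -> X) : Prop :=
  [/\ is_map f, is_map g, map_le id (g \o f) & map_le (f \o g) id].

Definition pt_le (X : space) (x y : X) : Prop :=
  qle (qone V) (conv X (ultra_unit x) y).

Definition T0 (X : space) : Prop := forall x y : X, pt_le x y -> pt_le y x -> x = y.

Definition isomorphic (X Y : space) : Prop :=
  exists (f : X -> Y) (g : Y -> X),
    [/\ is_map f, is_map g, cancel f g & cancel g f].

Lemma qten_mono (u u' v v' : V) :
  qle u u' -> qle v v' -> qle (qten u v) (qten u' v').
Proof.
have H (a b c : V) : qle b c -> qle (qten a b) (qten a c).
  move=> bc; have -> : c = qsup [set b; c].
    apply: qle_anti; first by apply: qsup_ub; right.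
    by apply: qsup_least => _ [->|->] //; exact: qle_refl.
  by rewrite qten_sup; apply: qsup_ub; exists b => //; left.
move=> uu' vv'; apply: qle_trans (H _ _ _ vv') _.
by rewrite qtenC (qtenC u'); exact: H.
Qed.

Lemma qten_bot (u : V) : qten u (qsup set0) = qsup set0.
Proof. by rewrite qten_sup image_set0. Qed.

Lemma bot_le (u : V) : qle (qsup set0) u.
Proof. exact: qsup_least. Qed.

Lemma kcomp_le (X Y Z : Type) (s : vrel V (ultra Y) Z) (r : vrel V (ultra X) Y)
    (F : ultra X) (z : Z) (v : V) :
  (forall FF G, ultra_mult FF = F ->
     qle (qten (ultra_rel r FF G) (s G z)) v) ->
  qle (kcomp s r F z) v.
Proof.
move=> H; apply: qsup_least => _ [G _ <-].
rewrite qtenC {1}/rcomp qten_sup; apply: qsup_least => _ [_ [FF _ <-] <-].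
rewrite /rconv /graph; case: asboolP => [E|_].
  by rewrite qten1 qtenC; exact: H.
by rewrite (qtenC (qsup set0)) qten_bot qten_bot; exact: bot_le.
Qed.

Lemma le_kcomp (X Y Z : Type) (s : vrel V (ultra Y) Z) (r : vrel V (ultra X) Y)
    (FF : ultra (ultra X)) (G : ultra Y) (z : Z) :
  qle (qten (ultra_rel r FF G) (s G z)) (kcomp s r (ultra_mult FF) z).
Proof.
apply: qle_trans (qsup_ub (u := qten _ (s G z)) _); last by exists G.
apply: qten_mono; last exact: qle_refl.
apply: qle_trans (qsup_ub (u := qten (qone V) (ultra_rel r FF G)) _).
  by rewrite qten1; exact: qle_refl.
by exists FF => //; rewrite /rconv /graph asboolT.
Qed.

Lemma ultra_rel_map (X Y X' Y' : Type) (f : X -> X') (g : Y -> Y')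
    (r : vrel V X Y) (r' : vrel V X' Y') F G :
  (forall x y, qle (r x y) (r' (f x) (g y))) ->
  qle (ultra_rel r F G) (ultra_rel r' (ultra_map f F) (ultra_map g G)).
Proof.
move=> rr'; apply: qinf_greatest => _ [A [B [FA GB ->]]].
apply: qle_trans (qinf_lb _) _.
  by exists (f @^-1` A), (g @^-1` B); split; first exact: FA; first exact: GB.
apply: qsup_least => _ [x [y [Ax By ->]]].
by apply: qle_trans (rr' x y) (qsup_ub _); exists (f x), (g y).
Qed.

Lemma ultra_mult_map (X Y : Type) (f : X -> Y) (FF : ultra (ultra X)) :
  ultra_mult (ultra_map (ultra_map f) FF) = ultra_map f (ultra_mult FF).
Proof. exact: ultra_ext. Qed.

Lemma ultra_map_unit (X Y : Type) (f : X -> Y) (x : X) :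
  ultra_map f (ultra_unit x) = ultra_unit (f x).
Proof. exact: ultra_ext. Qed.

Lemma ultra_mult_unit (X : Type) (F : ultra X) : ultra_mult (ultra_unit F) = F.
Proof. exact: ultra_ext. Qed.

Lemma ultra_mult_map_unit (X : Type) (F : ultra X) :
  ultra_mult (ultra_map (@ultra_unit X) F) = F.
Proof. exact: ultra_ext. Qed.

Lemma ultra_map_id (X : Type) (F : ultra X) : ultra_map id F = F.
Proof. exact: ultra_ext. Qed.

Lemma ultra_map_comp (X Y Z : Type) (f : X -> Y) (g : Y -> Z) (F : ultra X) :
  ultra_map g (ultra_map f F) = ultra_map (g \o f) F.
Proof. exact: ultra_ext. Qed.

Lemma conv_unit (X : space) (x : X) : qle (qone V) (conv X (ultra_unit x) x).
Proof.
apply: qle_trans (str_unit (str X) (ultra_unit x) x).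
by rewrite /rconv /graph asboolT //; exact: qle_refl.
Qed.

Lemma conv_assoc (X : space) FF G (x : X) :
  qle (qten (ultra_rel (conv X) FF G) (conv X G x))
      (conv X (ultra_mult FF) x).
Proof. exact: qle_trans (le_kcomp _ _ _ _ _) (str_assoc (str X) _ _). Qed.

Lemma space_str_intro (X : Type) (a : vrel V (ultra X) X) :
  (forall x, qle (qone V) (a (ultra_unit x) x)) ->
  (forall FF G x, qle (qten (ultra_rel a FF G) (a G x))
                      (a (ultra_mult FF) x)) ->
  {s : space_str X | str_conv s = a}.
Proof.
move=> a1 aA.
have a1' : rel_le (rconv (graph (@ultra_unit X))) a.
  move=> F x; rewrite /rconv /graph; case: asboolP => [<-|_]; first exact: a1.
  exact: bot_le.
have aA' : rel_le (rcomp a (rcomp (ultra_rel a)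
                        (rconv (graph (@ultra_mult X))))) a.
  by move=> F x; apply: kcomp_le => FF G <-; exact: aA.
by exists (SpaceStr a1' aA').
Qed.

Lemma indiscrete_subproof (X : Type) :
  {s : space_str X | str_conv s = fun _ _ => qone V}.
Proof.
apply: space_str_intro => [x|FF G x]; first exact: qle_refl.
exact: qone_top.
Qed.

Definition indiscrete (X : Type) : space_str X := sval (indiscrete_subproof X).

Definition one_space : space := Space (indiscrete unit).

Lemma subspace_subproof (X : space) (P : X -> Prop) :
  {s : space_str {x : X | P x} |
    str_conv s = fun F x => conv X (ultra_map sval F) (sval x)}.
Proof.
apply: space_str_intro => [x|FF G x].
  by rewrite ultra_map_unit; exact: conv_unit.
rewrite -ultra_mult_map; apply: qle_trans (conv_assoc _ _ _).
apply: qten_mono; last exact: qle_refl.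
by apply: ultra_rel_map => F y; exact: qle_refl.
Qed.

Definition subspace (X : space) (P : X -> Prop) : space :=
  Space (sval (subspace_subproof P)).

Definition tensor_conv (X Y : Type) (a : vrel V (ultra X) X)
    (b : vrel V (ultra Y) Y) : vrel V (ultra (X * Y)) (X * Y) :=
  fun W p => qten (a (ultra_map fst W) p.1) (b (ultra_map snd W) p.2).

Definition op_conv (X : space) : vrel V (ultra (ultra X)) (ultra X) :=
  fun FF F => rcomp (ultra_rel (conv X)) (rconv (graph (@ultra_mult X)))
                    F (ultra_mult FF).

Definition is_module (X Y : space) (r : vrel V (ultra X) Y) : Prop :=
  kcomp r (conv X) = r /\ kcomp (conv Y) r = r.

Definition lower_star (X Y : space) (f : X -> Y) : vrel V (ultra X) Y :=
  fun F y => conv Y (ultra_map f F) y.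

Definition upper_star (X Y : space) (f : X -> Y) : vrel V (ultra Y) X :=
  fun G x => conv Y G (f x).

Definition pt_star (X : space) (x : X) : vrel V (ultra X) one_space :=
  fun F _ => conv X F x.

Definition presheaf (X : space) : Type :=
  {psi : vrel V (ultra X) one_space | is_module psi}.

Definition exponential_str (X : space) (c : space_str (presheaf X)) : Prop :=
  forall (Z : space) (h : Z -> presheaf X),
    is_map_for (conv Z) c h <->
    is_map_for (tensor_conv (conv Z) (@op_conv X)) (@qconv V)
      (fun p : Z * ultra X => sval (h p.1) p.2 tt).

(* The structure of the exponential [V^(X^op)] is described by its universal
   property, which determines it; it exists, so that the second branch is never
   taken. *)
Definition presheaf_str (X : space) : space_str (presheaf X) :=
  if pselect (exists c, exponential_str c) is left e then sval (cid e)
  else indiscrete (presheaf X).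

Definition presheaf_space (X : space) : space := Space (presheaf_str X).

Record module_class : Type := ModuleClass {
  in_class : forall X Y : space, vrel V (ultra X) Y -> Prop;
  class_module : forall (X Y : space) (r : vrel V (ultra X) Y),
    in_class r -> is_module r;
  class_id : forall X : space, in_class (conv X);
  class_comp : forall (X Y Z : space) (s : vrel V (ultra Y) Z)
      (r : vrel V (ultra X) Y),
    in_class r -> in_class s -> in_class (kcomp s r);
  class_upper : forall (X Y : space) (f : X -> Y),
    is_map f -> in_class (upper_star f);
  class_pointwise : forall (X Y : space) (r : vrel V (ultra X) Y),
    is_module r ->
    (in_class r <-> forall y : Y, in_class (kcomp (pt_star y) r)) }.

Section Class.
Variable Phi : module_class.
Implicit Types X Y Z A B : space.

Definition dense_map X Y (f : X -> Y) : Prop :=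
  is_map f /\ in_class Phi (lower_star f).

Definition Phi_space X : space :=
  @subspace (presheaf_space X) (fun psi => in_class Phi (sval psi)).

Lemma pt_star_class X (x : X) : in_class Phi (pt_star x).
Proof.
have m : @is_map one_space X (fun=> x).
  move=> F t; apply: qle_trans (qone_top _) _.
  have -> : ultra_map (fun=> x) F = ultra_unit x; last exact: conv_unit.
  apply: ultra_ext => A /=; have FU := ultraP F; split=> [|Ax].
    by move=> /filter_ex[].
  by apply: filterS (@filterT _ (ultra_sets F) _).
exact: class_upper m.
Qed.

Definition yoneda X (x : X) : Phi_space X :=
  exist _ (exist _ (pt_star x) (class_module (pt_star_class x)))
        (pt_star_class x).

Definition is_Sup X (S : Phi_space X -> X) : Prop := left_adjoint S (@yoneda X).

Definition cocomplete X : Prop := exists S, @is_Sup X S.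

Definition distributive X : Prop :=
  T0 X /\ exists (S : Phi_space X -> X) (t : X -> Phi_space X),
    is_Sup S /\ left_adjoint t S.

Definition algebraic X : Prop :=
  distributive X /\ exists Y, isomorphic X (Phi_space Y).

Definition is_colimit A B X (d : B -> X) (psi : vrel V (ultra B) A)
    (g : A -> X) : Prop :=
  [/\ is_map g,
      rel_le (kcomp (lower_star g) psi) (lower_star d) &
      forall gamma : vrel V (ultra A) X, is_module gamma ->
        rel_le (kcomp gamma psi) (lower_star d) -> rel_le gamma (lower_star g)].

Definition cocontinuous X Y (f : X -> Y) : Prop :=
  forall A B (d : B -> X) (psi : vrel V (ultra B) A) (g : A -> X),
    is_map d -> in_class Phi psi -> is_colimit d psi g ->
    is_colimit (f \o d) psi (f \o g).

Definition right_adjoint_map X Y (f : X -> Y) : Prop :=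
  exists l : Y -> X, left_adjoint l f.

Definition left_adjoint_module X Y (r : vrel V (ultra X) Y) : Prop :=
  in_class Phi r /\ exists s : vrel V (ultra Y) X,
    [/\ in_class Phi s, rel_le (conv X) (kcomp s r) & rel_le (kcomp r s) (conv Y)].

Definition sober X : Prop :=
  T0 X /\ forall Y (r : vrel V (ultra Y) X), left_adjoint_module r ->
    exists! f : Y -> X, is_map f /\ r = lower_star f.

End Class.
End Relations.

Arguments conv {V} X _ _.

Record category : Type := Category {
  obj :> Type;
  hom : obj -> obj -> Type;
  idm : forall X, hom X X;
  comp : forall X Y Z, hom X Y -> hom Y Z -> hom X Z;
  comp_idl : forall X Y (f : hom X Y), comp (idm X) f = f;
  comp_idr : forall X Y (f : hom X Y), comp f (idm Y) = f;
  compA : forall X Y Z W (f : hom X Y) (g : hom Y Z) (h : hom Z W),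
    comp f (comp g h) = comp (comp f g) h }.

Definition opposite (C : category) : category :=
  @Category (obj C) (fun X Y => hom Y X) (fun X => idm X)
    (fun X Y Z f g => comp g f) (fun X Y f => comp_idr f)
    (fun X Y f => comp_idl f) (fun X Y Z W f g h => esym (compA h g f)).

Record functor (C D : category) : Type := Functor {
  fobj :> C -> D;
  fhom : forall X Y, hom X Y -> hom (fobj X) (fobj Y);
  fhom_id : forall X, fhom (idm X) = idm (fobj X);
  fhom_comp : forall X Y Z (f : hom X Y) (g : hom Y Z),
    fhom (comp f g) = comp (fhom f) (fhom g) }.

Definition functor_id (C : category) : functor C C :=
  @Functor C C id (fun X Y f => f) (fun X => erefl) (fun X Y Z f g => erefl).

Definition functor_comp (C D E : category) (F : functor C D) (G : functor D E) :
  functor C E.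
Proof.
refine (@Functor C E (fun X => G (F X)) (fun X Y f => fhom G (fhom F f)) _ _).
- by move=> X; rewrite !fhom_id.
- by move=> X Y Z f g; rewrite !fhom_comp.
Defined.

Definition naturally_isomorphic (C D : category) (F G : functor C D) : Prop :=
  exists (t : forall X, hom (F X) (G X)) (s : forall X, hom (G X) (F X)),
    [/\ forall X Y (f : hom X Y),
          comp (fhom F f) (t Y) = comp (t X) (fhom G f),
        forall X, comp (t X) (s X) = idm (F X) &
        forall X, comp (s X) (t X) = idm (G X)].

Definition equivalent (C D : category) : Prop :=
  exists (F : functor C D) (G : functor D C),
    naturally_isomorphic (functor_comp F G) (functor_id C) /\
    naturally_isomorphic (functor_comp G F) (functor_id D).

Definition dually_equivalent (C D : category) : Prop :=
  equivalent C (opposite D).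

Definition space_category (V : quantale) (P : space V -> Prop)
    (Q : forall X Y : space V, (X -> Y) -> Prop)
    (Q_id : forall X : space V, Q X X id)
    (Q_comp : forall (X Y Z : space V) (f : X -> Y) (g : Y -> Z),
      Q X Y f -> Q Y Z g -> Q X Z (g \o f)) : category.
Proof.
refine (@Category {X : space V | P X}
  (fun X Y => {f : sval X -> sval Y | Q _ _ f})
  (fun X => exist _ id (Q_id (sval X)))
  (fun X Y Z f g => exist _ (sval g \o sval f) (Q_comp _ _ _ _ _ (svalP f) (svalP g)))
  _ _ _).
- by move=> X Y [f qf]; apply: eq_exist.
- by move=> X Y [f qf]; apply: eq_exist.
- by move=> X Y Z W [f qf] [g qg] [h qh]; apply: eq_exist.
Defined.

Section Morphisms.
Variables (V : quantale) (Phi : module_class V).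
Implicit Types X Y Z : space V.

Lemma is_map_id X : is_map (X := X) id.
Proof. by move=> F x; rewrite ultra_map_id; exact: qle_refl. Qed.

Lemma is_map_comp X Y Z (f : X -> Y) (g : Y -> Z) :
  is_map f -> is_map g -> is_map (g \o f).
Proof.
move=> mf mg F x; rewrite -ultra_map_comp.
exact: qle_trans (mf F x) (mg _ _).
Qed.

Lemma ultra_rel_principal (X Y : Type) (r : vrel V X Y) x y :
  qle (r x y) (ultra_rel r (ultra_unit x) (ultra_unit y)).
Proof.
by apply: qinf_greatest => _ [A [B [/= Ax By ->]]]; apply: qsup_ub; exists x, y.
Qed.

Lemma pt_le_trans X (x y z : X) : pt_le x y -> pt_le y z -> pt_le x z.
Proof.
move=> xy yz; rewrite /pt_le -(ultra_mult_unit (ultra_unit x)).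
apply: qle_trans (conv_assoc _ (ultra_unit y) _).
rewrite -{1}(qten1 (qone V)); apply: qten_mono => //.
exact: qle_trans xy (ultra_rel_principal _ _ _).
Qed.

Lemma pt_le_map X Y (f : X -> Y) (x y : X) :
  is_map f -> pt_le x y -> pt_le (f x) (f y).
Proof.
move=> mf xy; rewrite /pt_le -ultra_map_unit.
exact: qle_trans xy (mf _ _).
Qed.

Lemma lower_star_comp X Y Z (f : X -> Y) (g : Y -> Z) :
  is_map f -> is_map g ->
  lower_star (g \o f) = kcomp (lower_star g) (lower_star f).
Proof.
move=> mf mg; apply/funext => F; apply/funext => z; apply: qle_anti.
  rewrite -{2}(ultra_mult_map_unit F).
  apply: qle_trans (le_kcomp _ _ _ (ultra_map f F) _).
  rewrite /lower_star ultra_map_comp -{1}(qten1 (conv _ _ _)).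
  apply: qten_mono; last exact: qle_refl.
  apply: qinf_greatest => _ [A [B [FA FB ->]]].
  have FU := ultraP F; have [x [Ax Bx]] :=
    filter_ex (@filterI _ (ultra_sets F) _ (_ @^-1` A) (_ @^-1` B) FA FB).
  apply: qle_trans (qsup_ub _); last by exists (ultra_unit x), (f x).
  by rewrite ultra_map_unit; exact: conv_unit.
apply: kcomp_le => FF G <-.
rewrite /lower_star -ultra_map_comp -!ultra_mult_map.
apply: qle_trans (conv_assoc _ (ultra_map g G) _).
apply: qten_mono; last exact: qle_refl.
rewrite ultra_map_comp; apply: ultra_rel_map => H y.
exact: mg.
Qed.

Lemma dense_map_id X : dense_map Phi (X := X) id.
Proof.
split; first exact: is_map_id.
have -> : lower_star (X := X) id = conv X; last exact: class_id.
by apply/funext => F; rewrite /lower_star ultra_map_id.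
Qed.

Lemma dense_map_comp X Y Z (f : X -> Y) (g : Y -> Z) :
  dense_map Phi f -> dense_map Phi g -> dense_map Phi (g \o f).
Proof.
move=> [mf df] [mg dg]; split; first exact: is_map_comp.
by rewrite lower_star_comp //; exact: class_comp.
Qed.

Definition algebraic_map X Y (f : X -> Y) : Prop :=
  [/\ is_map f, right_adjoint_map f & cocontinuous Phi f].

Lemma algebraic_map_id X : algebraic_map (X := X) id.
Proof.
split; [exact: is_map_id| |by move=> A B d psi g].
exists id; split; [exact: is_map_id|exact: is_map_id| |] => x;
  exact: conv_unit.
Qed.

Lemma algebraic_map_comp X Y Z (f : X -> Y) (g : Y -> Z) :
  algebraic_map f -> algebraic_map g -> algebraic_map (g \o f).
Proof.
move=> [mf [l [ml _ fl lf]] cf] [mg [k [mk _ gk kg]] cg].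
split; first exact: is_map_comp.
  exists (l \o k); split; [exact: is_map_comp|exact: is_map_comp| |].
    move=> z; apply: (pt_le_trans (y := g (k z))); first exact: gk.
    exact: (pt_le_map mg (fl (k z))).
  move=> x; apply: (pt_le_trans (y := l (f x))); last exact: lf.
  exact: (pt_le_map ml (kg (f x))).
move=> A B d psi h md Ppsi colim.
apply: (cg A B (f \o d) psi (f \o h)) => //; first exact: is_map_comp.
exact: cf.
Qed.

Definition Sob : category :=
  space_category (@sober V Phi) dense_map_id dense_map_comp.

Definition Alg : category :=
  space_category (@algebraic V Phi) algebraic_map_id algebraic_map_comp.

End Morphisms.

(* Main.v *)
From mathcomp Require Import all_boot all_order ssralg ssrnum.
From mathcomp Require Import boolp classical_sets filter.
From mathcomp Require Import reals constructive_ereal ereal.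
Require Import Defs.
Set Implicit Arguments.
Unset Strict Implicit.
Unset Printing Implicit Defensive.
Import Order.TTheory GRing.Theory Num.Theory.
Local Open Scope classical_set_scope.

(* Write [y] for the Yoneda embedding [Z -> Phi Z]. Its module [y_*] is the
   evaluation [(F, p) |-> p F], and a map [d : B -> Phi Z] is the same thing as
   a module [D : Z -|-> B] in the class. The structure of [Phi Z] is such that
   [gamma <= d_*] iff [gamma o D <= y_*] and [gamma <= d^*] iff
   [gamma o y_* <= D]. The first equivalence shows that the colimit of [d]
   weighted by [psi] corresponds to [psi o D]; hence a cocontinuous map
   [Phi Y -> Phi X] is precomposition with a module [phi : X -|-> Y], and it has
   a left adjoint iff [phi] is left adjoint in the class. If [Y] is sober, such
   [phi] are the [f_*] with [f] dense, so that [Phi], acting on [f] by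
   [psi |-> psi o f_*], is fully faithful. For essential surjectivity, the
   points [p] of [Phi Z] with [p^* = p o y^*] form a sober subspace [A], and
   [Z], [A] are isomorphic as objects of the category of modules of the class,
   so [Phi Z] and [Phi A] are isomorphic. *)

#[local] Existing Instance ultraP.

(** * Limits along ultrafilters *)

Section Ultrafilters.
Implicit Types T X Y : Type.

Lemma ultra_nonempty T (F : ultra T) A : F A -> A !=set0.
Proof. exact: filter_ex. Qed.

Lemma ultra_capture T (F : ultra T) A : (F (~` A) -> False) -> F A.
Proof. by case: (in_ultra_setVsetC A (ultraP F)). Qed.

Lemma ultra_sub_eq T (F G : ultra T) : (forall A, F A -> G A) -> F = G.
Proof.
move=> FG; apply: ultra_ext => A; split=> [|GA]; first exact: FG.
apply: ultra_capture => FnA.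
by have [x [? ?]] := ultra_nonempty (filterI GA (FG _ FnA)).
Qed.

Lemma ultra_extend T (G : set_system T) :
  ProperFilter G -> exists F : ultra T, forall A, G A -> F A.
Proof. by move=> /ultraFilterLemma[F [FU GF]]; exists (Ultra FU). Qed.

End Ultrafilters.

Section Quantales.
Variable V : quantale.
Implicit Types (u v w : V) (S : set V).

(* The totally below relation of the complete lattice [V]. *)
Definition qll v u : Prop :=
  forall S, qle u (qsup S) -> exists2 s, S s & qle v s.

(** A limes superior in the order of [V]. Over a regular quantale it is also the limes inferior
    along [F], which is what [qlim_qll] and [qlim_ge] together express. *)
Definition qlim (T : Type) (F : ultra T) (f : T -> V) : V :=
  qinf [set qsup (f @` A) | A in ultra_sets F].

(* Common to the two quantales of the theorem; [qle_approx] is complete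
   distributivity, and [qconvP] says that [qconv F u] is the residual of [u] by
   the limit of [F]. *)
Record regular_quantale : Prop := RegularQuantale {
  qle_total : forall u v, qle u v \/ qle v u;
  qle_approx : forall u w, (forall v, qll v u -> qle v w) -> qle u w;
  qten_inf : forall u S, S !=set0 ->
    qle (qinf (qten u @` S)) (qten u (qinf S));
  qconvP : forall (F : ultra V) u w,
    qle w (qconv F u) <-> qle (qten w (qlim F id)) u }.

Definition qres w u : V := qsup [set v | qle (qten v w) u].

Lemma qresP u v w : qle v (qres w u) <-> qle (qten v w) u.
Proof.
split=> [vr|vwu]; last exact: qsup_ub.
apply: qle_trans (qten_mono vr (qle_refl w)) _.
rewrite qtenC /qres qten_sup; apply: qsup_least => _ [x xw <-].
by rewrite qtenC.
Qed.

Lemma qten1r u : qten u (qone V) = u.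
Proof. by rewrite qtenC qten1. Qed.

Lemma qten_le_l u v w : qle u v -> qle (qten u w) (qten v w).
Proof. by move=> uv; apply: qten_mono (qle_refl _). Qed.

Lemma qten_le_r u v w : qle u v -> qle (qten w u) (qten w v).
Proof. exact: qten_mono (qle_refl _). Qed.

Lemma qsup_le S S' :
  (forall u, S u -> exists2 v, S' v & qle u v) -> qle (qsup S) (qsup S').
Proof.
move=> SS'; apply: qsup_least => u /SS'[v Sv uv].
exact: qle_trans uv (qsup_ub Sv).
Qed.

Section Limits.
Hypothesis HV : regular_quantale.
Variables (T : Type).
Implicit Types (F : ultra T) (f g : T -> V).

(** Residuation moves one factor to the other side, so that complete distributivity can be applied
    to the factors one at a time. *)
Lemma qle_approx_ten u u' w :
  (forall v v', qll v u -> qll v' u' -> qle (qten v v') w) -> qle (qten u u') w.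
Proof.
move=> H; apply/qresP; apply: (qle_approx HV) => v vu; apply/qresP.
rewrite qtenC; apply/qresP; apply: (qle_approx HV) => v' vu'; apply/qresP.
by rewrite qtenC; exact: H.
Qed.

Lemma qle_of_qll v u : qll v u -> qle v u.
Proof.
move=> /(_ [set u]); case=> [|_ -> //]; exact: qsup_ub.
Qed.

Lemma qlim_le F f u A :
  F A -> (forall x, A x -> qle (f x) u) -> qle (qlim F f) u.
Proof.
move=> FA fu; apply: qle_trans (qinf_lb _) _.
  by exists A; first exact: FA.
by apply: qsup_least => _ [x Ax <-]; exact: fu.
Qed.

(** Otherwise the complement of this set is in [F], so the join of [f] over it is above the limit,
    and total belowness yields a point of the complement where [f] is above [v]. *)
Lemma qlim_qll F f v : qll v (qlim F f) -> F [set x | qle v (f x)].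
Proof.
move=> vl; apply: ultra_capture => FC.
have [|_ [x Cx <-] vx] := vl (f @` (~` [set x | qle v (f x)])).
  by apply: qinf_lb; exists (~` [set x | qle v (f x)]).
exact: (Cx vx).
Qed.

Lemma qlim_ge F f v : F [set x | qle v (f x)] -> qle v (qlim F f).
Proof.
move=> Fv; apply: qinf_greatest => _ [A FA <-].
have [x [/= vx Ax]] := ultra_nonempty (filterI Fv FA).
by apply: qle_trans vx (qsup_ub _); exists x.
Qed.

(** From below, both limits are approximated by totally below elements. From above, [qten_inf] pulls
    the two infima out of the tensor, and sets [A] and [B] of [F] are compared on their
    intersection. *)
Lemma qlim_ten F f g :
  qlim F (fun x => qten (f x) (g x)) = qten (qlim F f) (qlim F g).
Proof.
have FT : ultra_sets F setT by exact: filterT.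
apply: qle_anti; last first.
  apply: qle_approx_ten => v v' /qlim_qll Fv /qlim_qll Fv'.
  apply: qlim_ge; apply: filterS (filterI Fv Fv') => x /= [vx vx'].
  exact: qten_mono.
apply: qle_trans (qten_inf HV _ _); last by exists (qsup (g @` setT)), setT.
apply: qinf_greatest => _ [_ [B FB <-] <-]; rewrite qtenC.
apply: qle_trans (qten_inf HV _ _); last by exists (qsup (f @` setT)), setT.
apply: qinf_greatest => _ [_ [A FA <-] <-]; rewrite qtenC.
apply: (qlim_le (filterI FA FB)) => x [Ax Bx].
by apply: qten_mono; apply: qsup_ub; exists x.
Qed.

(* The totally below elements of [u] form a chain, so that the sets
   [{x | v <= f x}] for [v] totally below [u] can be added to [G]. *)
Lemma ultra_above (G : set_system T) f u : ProperFilter G ->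
  (forall A, G A -> qle u (qsup (f @` A))) ->
  exists2 F : ultra T, (forall A, G A -> F A) & qle u (qlim F f).
Proof.
(* The bottom element is adjoined because nothing is totally below [u] when [u] is bottom, and [H]
   must contain [G] in that case too. *)
move=> GF Gu; pose below v := v = qsup set0 \/ qll v u.
pose H := [set B | exists A v, [/\ G A, below v &
  A `&` [set x | qle v (f x)] `<=` B]].
have H0 : ~ H set0.
  move=> [A [v [GA [->|vu] AB]]].
    have [x Ax] := filter_ex GA; apply: (AB x); split=> //; exact: bot_le.
  have [_ [x Ax <-] vx] := vu _ (Gu A GA); exact: (AB x).
have HF : ProperFilter H.
  split=> //; split.
  - by exists setT, (qsup set0); split; [exact: filterT|left|].
  - move=> B B' [A [v [GA bv AB]]] [A' [v' [GA' bv' AB']]].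
    exists (A `&` A'); case: (qle_total HV v v') => vv'.
    + exists v'; split=> // [|x [[Ax A'x] v'x]]; first exact: filterI.
      by split; [apply: AB; split=> //; exact: qle_trans v'x|exact: AB'].
    + exists v; split=> // [|x [[Ax A'x] vx]]; first exact: filterI.
      by split; [exact: AB|apply: AB'; split=> //; exact: qle_trans vx].
  - move=> B B' BB' [A [v [GA bv AB]]]; exists A, v; split=> //.
    exact: subset_trans BB'.
have [F HsubF] := ultra_extend HF; exists F => [A GA|].
  apply: HsubF; exists A, (qsup set0); split=> //; by left.
apply: (qle_approx HV) => v vu; apply: qlim_ge; apply: HsubF.
exists setT, v; split; [exact: filterT|by right|by move=> x []].
Qed.

End Limits.

Lemma qlim_map (S T : Type) (p : S -> T) (F : ultra S) (f : T -> V) :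
  qlim (ultra_map p F) f = qlim F (f \o p).
Proof.
apply: qle_anti; apply: qinf_greatest => _ [A FA <-].
  apply: (@qlim_le _ _ _ _ (p @` A)) => [|_ [x Ax <-]].
    by apply: filterS FA => x Ax; exists x.
  by apply: qsup_ub; exists x.
apply: (@qlim_le _ F _ _ (p @^-1` A)) => // x Ax.
by apply: qsup_ub; exists (p x).
Qed.

Hypothesis HV : regular_quantale.

(* [p] need not be onto. *)
Lemma qlim_lift_le (S T : Type) (p : S -> T) (F : ultra T) (f : S -> V)
    (g : T -> V) w :
  (forall t, qle (g t) (qsup (f @` (p @^-1` [set t])))) ->
  (forall G : ultra S, ultra_map p G = F -> qle (qlim G f) w) ->
  qle (qlim F g) w.
Proof.
move=> gf fw; apply: (qle_approx HV) => v0 v0F.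
pose H := [set B | exists2 A, F A & p @^-1` A `<=` B].
have lift A : F A -> qle (qlim F g) (qsup (f @` (p @^-1` A))).
  move=> FA; apply: (qlim_le FA) => t At; apply: qle_trans (gf t) _.
  apply: qsup_le => _ [s /= pst <-]; exists (f s); last exact: qle_refl.
  by exists s => //=; rewrite pst.
have HF : ProperFilter H.
  split; last split.
  - by move=> [A /lift/v0F[_ [s As _] _] /(_ s As)].
  - by exists setT; first exact: filterT.
  - move=> B B' [A FA AB] [A' FA' AB']; exists (A `&` A'); first exact: filterI.
    by move=> s [/AB Bs /AB' B's].
  - by move=> B B' BB' [A FA AB]; exists A => //; exact: subset_trans BB'.
have [|G HG FG] := @ultra_above HV _ _ f (qlim F g) HF.
  move=> B [A FA AB]; apply: qle_trans (lift A FA) _.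
  apply: qsup_le => _ [s /AB Bs <-].
  by exists (f s); [exists s|exact: qle_refl].
apply: qle_trans (qle_of_qll v0F) _; apply: qle_trans FG _; apply: fw.
by apply/esym/ultra_sub_eq => A FA; apply: HG; exists A.
Qed.

End Quantales.

(** * The ultrafilter extension of relations and Kleisli composition *)

Lemma ultra_multA (X : Type) (FFF : ultra (ultra (ultra X))) :
  ultra_mult (ultra_mult FFF) = ultra_mult (ultra_map (@ultra_mult X) FFF).
Proof. exact: ultra_ext. Qed.

Section UltraRelations.
Variable V : quantale.
Hypothesis HV : regular_quantale V.
Implicit Types (W X Y Z : Type).

Lemma ultra_rel_ge X Y (r : vrel V X Y) (F : ultra X) (G : ultra Y) (u : V) :
  (forall A B, F A -> G B ->
     qle u (qsup [set w | exists x y, [/\ A x, B y & w = r x y]])) ->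
  qle u (ultra_rel r F G).
Proof. by move=> H; apply: qinf_greatest => _ [A [B [FA GB ->]]]; exact: H. Qed.

Lemma ultra_rel_lb X Y (r : vrel V X Y) (F : ultra X) (G : ultra Y) A B :
  F A -> G B ->
  qle (ultra_rel r F G) (qsup [set w | exists x y, [/\ A x, B y & w = r x y]]).
Proof. by move=> FA GB; apply: qinf_lb; exists A, B. Qed.

Lemma ultra_rel_mono X Y (r r' : vrel V X Y) :
  rel_le r r' -> rel_le (ultra_rel r) (ultra_rel r').
Proof.
by move=> rr' F G; rewrite -[F in X in qle _ X]ultra_map_id
  -[G in X in qle _ X]ultra_map_id; exact: ultra_rel_map.
Qed.

Lemma qlim_ultra_rel W X Y (p : W -> X) (q : W -> Y) (r : vrel V X Y)
    (F : ultra W) :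
  qle (qlim F (fun w => r (p w) (q w)))
      (ultra_rel r (ultra_map p F) (ultra_map q F)).
Proof.
apply: ultra_rel_ge => A B FA FB.
apply: (qlim_le (filterI (F := ultra_sets F) FA FB)) => w [/= Aw Bw].
by apply: qsup_ub; exists (p w), (q w).
Qed.

(** An application of [ultra_above] to the product filter. Filters are allowed instead of
    ultrafilters for the sake of [ultra_rel_mult_lift]. *)
Lemma ultra_above_prod X Y (f : set_system X) (g : set_system Y)
    (r : vrel V X Y) (u : V) : ProperFilter f -> ProperFilter g ->
  (forall A B, f A -> g B ->
     qle u (qsup [set w | exists x y, [/\ A x, B y & w = r x y]])) ->
  exists W : ultra (X * Y), [/\ forall A, f A -> ultra_map fst W A,
    forall B, g B -> ultra_map snd W B & qle u (qlim W (fun p => r p.1 p.2))].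
Proof.
move=> ff gf fgu.
have [|W fgW uW] := @ultra_above _ HV _ (filter_prod f g)
    (fun p => r p.1 p.2) u _.
  move=> C [[A B] [/= fA gB] ABC]; apply: qle_trans (fgu A B fA gB) _.
  apply: qsup_le => _ [x [y [Ax By ->]]].
  by exists (r x y); [exists (x, y) => //; exact: ABC|exact: qle_refl].
exists W; split=> // A fA; apply: fgW.
  by exists (A, setT) => [|p [] //]; split=> //; exact: filterT.
by exists (setT, A) => [|p [] //]; split=> //; exact: filterT.
Qed.

(** The infimum defining [ultra_rel] becomes a limit along one ultrafilter on the product, to which
    [qlim_ten] and [qlim_lift_le] apply. *)
Lemma ultra_rel_lift X Y (r : vrel V X Y) (F : ultra X) (G : ultra Y) :
  exists W : ultra (X * Y), [/\ ultra_map fst W = F, ultra_map snd W = G &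
    ultra_rel r F G = qlim W (fun p => r p.1 p.2)].
Proof.
have [W [WF WG le]] := @ultra_above_prod _ _ _ _ r _ _ _
  (@ultra_rel_lb _ _ r F G).
have EF := ultra_sub_eq WF; have EG := ultra_sub_eq WG.
exists W; split=> //; apply: qle_anti => //.
by rewrite [in X in qle _ X]EF [in X in qle _ X]EG; exact: qlim_ultra_rel.
Qed.

(** Lax functoriality of the extension. For [A] in [F] and [v] totally below the first factor, the
    points reached from [A] with value at least [v] form a set of [G], which can then be used in the
    second factor. *)
Lemma ultra_rel_comp X Y Z (r : vrel V X Y) (s : vrel V Y Z) (t : vrel V X Z)
    F G H :
  (forall x y z, qle (qten (r x y) (s y z)) (t x z)) ->
  qle (qten (ultra_rel r F G) (ultra_rel s G H)) (ultra_rel t F H).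
Proof.
move=> rst; apply: (qle_approx_ten HV) => v w vr ws.
apply: ultra_rel_ge => A C FA HC.
have GB : G [set y | exists2 x, A x & qle v (r x y)].
  apply: ultra_capture => GB.
  have [_ [x [y [Ax nB ->]]] vxy] := vr _ (ultra_rel_lb r FA GB).
  by apply: nB; exists x.
have [_ [y [z [[x Ax vxy] Cz ->]]] wyz] := ws _ (ultra_rel_lb s GB HC).
apply: qle_trans (qten_mono vxy wyz) _; apply: qle_trans (rst _ _ _) _.
by apply: qsup_ub; exists x, z.
Qed.

Lemma ultra_rel_mult X Y (r : vrel V X Y) FF GG :
  qle (ultra_rel (ultra_rel r) FF GG)
      (ultra_rel r (ultra_mult FF) (ultra_mult GG)).
Proof.
apply: ultra_rel_ge => A B FA GB.
apply: qle_trans (@ultra_rel_lb _ _ _ FF GG (sharp A) (sharp B) FA GB) _.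
apply: qsup_least => _ [F [G [FA' GB' ->]]]; exact: ultra_rel_lb.
Qed.

(** A converse of [ultra_rel_mult], up to the choice of [FF]. An ultrafilter has multiplication [F]
    as soon as it contains [sharp A] for each [A] in [F]; these sets generate the filter [f], and
    [ultra_above_prod] extends it against [GG]. *)
Lemma ultra_rel_mult_lift X Y (r : vrel V X Y) (F : ultra X) GG :
  exists2 FF, ultra_mult FF = F &
    qle (ultra_rel r F (ultra_mult GG)) (ultra_rel (ultra_rel r) FF GG).
Proof.
pose f := [set A' | exists2 A, F A & sharp A `<=` A'].
have ff : ProperFilter f.
  split; last split.
  - move=> [A /ultra_nonempty[x Ax] A0]; exact: (A0 (ultra_unit x)).
  - by exists setT; first exact: filterT.
  - move=> B B' [A FA AB] [A' FA' AB']; exists (A `&` A'); first exact: filterI.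
    move=> G GAA'; have GI : ultra_sets G (A `&` A') by [].
    by split; [apply: AB|apply: AB']; apply: filterS GI => x [].
  - by move=> B B' BB' [A FA AB]; exists A => //; exact: subset_trans BB'.
have [|W [Wf WG le]] := @ultra_above_prod _ _ f GG (ultra_rel r)
    (ultra_rel r F (ultra_mult GG)) ff _.
  move=> A' BB [A FA AA'] GB; apply: (qle_approx HV) => v vr.
  have GC : GG (sharp [set y | exists2 x, A x & qle v (r x y)]).
    apply: (@ultra_capture _ (ultra_mult GG)) => GC.
    have [_ [x [y [Ax nB ->]]] vxy] := vr _ (ultra_rel_lb r FA GC).
    by apply: nB; exists x.
  have [G [GG' BG]] := ultra_nonempty (filterI GC GB).
  have [x0 Ax0] := ultra_nonempty FA.
  (* Given [G] in [BB], a partner is needed that contains [A] and is related to [G] with value at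
     least [v]; it is the first projection of [W]. *)
  have [|W [WA WG vW]] := @ultra_above_prod _ _ (globally A) G r v
      (globally_properfilter Ax0) _.
    move=> A1 B1 AA1 GB1; have [y [[x Ax vxy] B1y]] :=
      ultra_nonempty (filterI (F := ultra_sets G) GG' GB1).
    by apply: qle_trans vxy (qsup_ub _); exists x, y; split=> //; exact: AA1.
  apply: qle_trans vW _; apply: qle_trans (qlim_ultra_rel fst snd r W) _.
  apply: qsup_ub; exists (ultra_map fst W), (ultra_map snd W).
  by split=> //; [apply/AA'/WA|rewrite -(ultra_sub_eq WG)].
exists (ultra_map fst W).
  by apply/esym/ultra_sub_eq => A FA; apply: Wf; exists A.
rewrite [in X in qle _ X](ultra_sub_eq WG); apply: qle_trans le _.
exact: (qlim_ultra_rel fst snd (ultra_rel r)).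
Qed.

Lemma ultra_rel_unitr X Y (r : vrel V X Y) F y :
  ultra_rel r F (ultra_unit y) = qlim F (r^~ y).
Proof.
apply: qle_anti.
  apply: qinf_greatest => _ [A FA <-].
  have yy : ultra_unit y [set y] by [].
  apply: qle_trans (ultra_rel_lb r FA yy) _.
  by apply: qsup_least => _ [x [_ [Ax -> ->]]]; apply: qsup_ub; exists x.
apply: ultra_rel_ge => A B FA By; apply: (qlim_le FA) => x Ax.
by apply: qsup_ub; exists x, y.
Qed.

Lemma ultra_rel_preimage X Y X' Y' (p : X' -> X) (q : Y' -> Y) (r : vrel V X Y)
    F G :
  ultra_rel (fun x y => r (p x) (q y)) F G =
  ultra_rel r (ultra_map p F) (ultra_map q G).
Proof.
apply: qle_anti; first by apply: ultra_rel_map => x y; exact: qle_refl.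
apply: ultra_rel_ge => A B FA GB.
have FA' : ultra_map p F (p @` A) by apply: filterS FA => x Ax; exists x.
have GB' : ultra_map q G (q @` B) by apply: filterS GB => y By; exists y.
apply: qle_trans (ultra_rel_lb r FA' GB') _.
apply: qsup_least => _ [_ [_ [[x Ax <-] [y By <-] ->]]].
by apply: qsup_ub; exists x, y.
Qed.

Lemma kcomp_mono X Y Z (r r' : vrel V (ultra X) Y) (s s' : vrel V (ultra Y) Z) :
  rel_le r r' -> rel_le s s' -> rel_le (kcomp s r) (kcomp s' r').
Proof.
move=> rr' ss' F z; apply: kcomp_le => FF G <-.
apply: qle_trans (le_kcomp _ _ FF G _).
exact: qten_mono (ultra_rel_mono rr' _ _) (ss' _ _).
Qed.

Lemma kcompA W X Y Z (r : vrel V (ultra W) X) (s : vrel V (ultra X) Y)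
    (t : vrel V (ultra Y) Z) :
  kcomp t (kcomp s r) = kcomp (kcomp t s) r.
Proof.
apply/funext => F; apply/funext => z; apply: qle_anti; last first.
  apply: kcomp_le => FF G <-; rewrite qtenC; apply/qresP.
  apply: kcomp_le => GG H GGG; apply/qresP; rewrite qtenC qtenA -GGG.
  (* In this direction the middle ultrafilter is a multiplication; lifting it reduces the claim to
     lax functoriality. *)
  have [FFF FFFE le] := ultra_rel_mult_lift r FF GG.
  apply: qle_trans (qten_le_l _ (qten_le_l _ le)) _.
  rewrite -FFFE ultra_multA; apply: qle_trans (le_kcomp _ _ _ H _).
  apply: qten_le_l.
  rewrite -[H in X in qle _ X]ultra_map_id -ultra_rel_preimage.
  apply: ultra_rel_comp => K L y; exact: le_kcomp.
apply: kcomp_le => FF H <-; apply/qresP.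
have [W0 [<- <- ->]] := ultra_rel_lift (kcomp s r) FF H.
(* A point of the fibre of [p] over a pair [(K, y)] is a term of the join defining [kcomp s r K y],
   so the limit of these joins is controlled by limits over triples. *)
pose p (q : ultra (ultra W) * ultra X * Y) := (ultra_mult q.1.1, q.2).
apply: (@qlim_lift_le _ HV _ _ p W0
  (fun q => qten (ultra_rel r q.1.1 q.1.2) (s q.1.2 q.2))).
  move=> [K y] /=; apply: kcomp_le => KK L E; apply: qsup_ub.
  by exists (KK, L, y); rewrite //= /p /= E.
move=> G <-; rewrite (qlim_ten HV); apply/qresP.
have -> : ultra_mult (ultra_map fst (ultra_map p G)) =
    ultra_mult (ultra_mult (ultra_map (fst \o fst) G)) by exact: ultra_ext.
have -> : ultra_map snd (ultra_map p G) = ultra_map snd G by exact: ultra_ext.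
rewrite -qtenA; apply: qle_trans (qten_mono _ _) (le_kcomp (kcomp t s) r
  (ultra_mult (ultra_map (fst \o fst) G))
  (ultra_mult (ultra_map (snd \o fst) G)) z).
  apply: qle_trans (ultra_rel_mult _ _ _).
  exact: (qlim_ultra_rel (fst \o fst) (snd \o fst) (ultra_rel r)).
apply: qle_trans (le_kcomp t s _ (ultra_map snd G) z); apply: qten_le_l.
exact: (qlim_ultra_rel (snd \o fst) snd s).
Qed.

End UltraRelations.

(** * Modules and presheaves *)

Section Modules.
Variable V : quantale.
Hypothesis HV : regular_quantale V.
Implicit Types (X Y Z B : space V).

Lemma rel_le_refl (X Y : Type) (r : vrel V X Y) : rel_le r r.
Proof. by move=> x y; exact: qle_refl. Qed.

Lemma rel_le_trans (X Y : Type) (r s t : vrel V X Y) :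
  rel_le r s -> rel_le s t -> rel_le r t.
Proof. by move=> rs st x y; exact: qle_trans (rs x y) (st x y). Qed.

Lemma rel_le_anti (X Y : Type) (r s : vrel V X Y) :
  rel_le r s -> rel_le s r -> r = s.
Proof.
by move=> rs sr; apply/funext => x; apply/funext => y; exact: qle_anti.
Qed.

Lemma kcomp_le_l (X Y Z : Type) (r : vrel V (ultra X) Y)
    (s s' : vrel V (ultra Y) Z) :
  rel_le s s' -> rel_le (kcomp s r) (kcomp s' r).
Proof. exact: kcomp_mono (@rel_le_refl _ _ _). Qed.

Lemma kcomp_le_r (X Y Z : Type) (r r' : vrel V (ultra X) Y)
    (s : vrel V (ultra Y) Z) :
  rel_le r r' -> rel_le (kcomp s r) (kcomp s r').
Proof. by move=> rr'; apply: kcomp_mono => //; exact: rel_le_refl. Qed.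

Lemma ultra_rel_unit_unitl (X : Type) (a : vrel V (ultra X) X) (F : ultra X) :
  (forall x, qle (qone V) (a (ultra_unit x) x)) ->
  qle (qone V) (ultra_rel a (ultra_map (@ultra_unit X) F) F).
Proof.
move=> a1; apply: ultra_rel_ge => A B FA FB.
have [x [/= Ax Bx]] := ultra_nonempty (filterI (F := ultra_sets F) FA FB).
by apply: qle_trans (a1 x) (qsup_ub _); exists (ultra_unit x), x.
Qed.

Lemma kcomp_conv_ge X (Y : Type) (r : vrel V (ultra X) Y) :
  rel_le r (kcomp r (conv X)).
Proof.
move=> F y; rewrite -{2}(ultra_mult_map_unit F).
apply: qle_trans (le_kcomp _ _ _ F y).
rewrite -{1}[r F y]qten1; apply: qten_le_l.
by apply: ultra_rel_unit_unitl => x; exact: conv_unit.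
Qed.

Lemma conv_kcomp_ge (X : Type) Y (r : vrel V (ultra X) Y) :
  rel_le r (kcomp (conv Y) r).
Proof.
move=> F y; rewrite -{2}(ultra_mult_unit F).
apply: qle_trans (le_kcomp _ _ _ (ultra_unit y) y).
rewrite -{1}[r F y]qten1r; apply: qten_mono; last exact: conv_unit.
exact: ultra_rel_principal.
Qed.

Lemma is_module_le X Y (r : vrel V (ultra X) Y) :
  rel_le (kcomp r (conv X)) r -> rel_le (kcomp (conv Y) r) r -> is_module r.
Proof.
move=> rX rY; split; apply: rel_le_anti => //.
  exact: kcomp_conv_ge.
exact: conv_kcomp_ge.
Qed.

Lemma rel_le_kcomp (X Y Z : Type) (s : vrel V (ultra Y) Z)
    (r : vrel V (ultra X) Y) (t : vrel V (ultra X) Z) :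
  rel_le (kcomp s r) t <->
  forall FF G z, qle (qten (ultra_rel r FF G) (s G z)) (t (ultra_mult FF) z).
Proof.
split=> [srt FF G z|H F z].
  exact: qle_trans (le_kcomp _ _ _ _ _) (srt _ _).
by apply: kcomp_le => FF G <-; exact: H.
Qed.

Lemma conv_module X : is_module (conv X).
Proof.
by apply: is_module_le; apply/rel_le_kcomp => FF G x; exact: conv_assoc.
Qed.

Lemma upper_starE X Y (Z : Type) (f : X -> Y) (r : vrel V (ultra Z) Y) :
  kcomp (upper_star f) r = fun F x => kcomp (conv Y) r F (f x).
Proof. by []. Qed.

Lemma upper_star_kcomp X Y Z (f : X -> Y) (r : vrel V (ultra Z) Y) :
  is_module r -> kcomp (upper_star f) r = fun F x => r F (f x).
Proof. by move=> [_ rY]; rewrite upper_starE rY. Qed.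

Lemma kcomp_lower_star X Y Z (f : X -> Y) (r : vrel V (ultra Y) Z) :
  is_map f -> is_module r ->
  kcomp r (lower_star f) = fun F z => r (ultra_map f F) z.
Proof.
move=> mf [rY _]; apply: rel_le_anti.
  apply/rel_le_kcomp => FF G z; rewrite -ultra_mult_map -[r in X in qle _ X]rY.
  apply: qle_trans (le_kcomp _ _ _ G z); apply: qten_le_l.
  by rewrite -[G in X in qle _ X]ultra_map_id; apply: ultra_rel_map => F y;
    exact: qle_refl.
move=> F z; rewrite -{2}(ultra_mult_map_unit F).
apply: qle_trans (le_kcomp _ _ _ (ultra_map f F) z).
rewrite -{1}[r _ z]qten1; apply: qten_le_l.
apply: ultra_rel_ge => A B FA FB.
have [x [/= Ax Bx]] := ultra_nonempty (filterI (F := ultra_sets F) FA FB).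
apply: qle_trans (conv_unit (f x)) (qsup_ub _); exists (ultra_unit x), (f x).
by split=> //; rewrite /lower_star ultra_map_unit.
Qed.

Lemma conv_kcomp_lower_star X Y (f : X -> Y) :
  rel_le (kcomp (conv Y) (lower_star f)) (lower_star f).
Proof.
apply/rel_le_kcomp => GG F y; rewrite /lower_star -ultra_mult_map.
apply: qle_trans (conv_assoc _ F _); apply: qten_le_l.
rewrite -[F in X in qle _ X]ultra_map_id; apply: ultra_rel_map => G z.
exact: qle_refl.
Qed.

Lemma lower_star_module X Y (f : X -> Y) : is_map f -> is_module (lower_star f).
Proof.
move=> mf; apply: is_module_le; last exact: conv_kcomp_lower_star.
apply/rel_le_kcomp => FF G y; rewrite /lower_star -ultra_mult_map.
apply: qle_trans (conv_assoc _ (ultra_map f G) _); apply: qten_le_l.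
exact: ultra_rel_map.
Qed.

Lemma map_le_lower_star X Y (f g : X -> Y) :
  rel_le (lower_star g) (lower_star f) -> map_le f g.
Proof.
move=> gf x; apply: qle_trans (conv_unit (g x)) _.
by rewrite -!ultra_map_unit; exact: gf.
Qed.

Lemma lower_star_inj X Y (f g : X -> Y) :
  T0 Y -> lower_star f = lower_star g -> f = g.
Proof.
move=> Y0 fg; apply/funext => x; apply: Y0; apply: map_le_lower_star;
  by rewrite fg; exact: rel_le_refl.
Qed.

Lemma star_unit X Y (f : X -> Y) :
  is_map f -> rel_le (conv X) (kcomp (upper_star f) (lower_star f)).
Proof.
move=> mf F x; rewrite upper_starE; apply: qle_trans (mf F x) _.
exact: (@conv_kcomp_ge _ Y (lower_star f) F (f x)).
Qed.

Lemma star_counit X Y (f : X -> Y) :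
  is_map f -> rel_le (kcomp (lower_star f) (upper_star f)) (conv Y).
Proof.
move=> mf; apply/rel_le_kcomp => GG F y; apply: qle_trans (conv_assoc _ _ _).
apply: qten_le_l; rewrite -[GG in X in qle _ X]ultra_map_id.
by apply: ultra_rel_map => G x; exact: qle_refl.
Qed.

Lemma module_conv X Y (r : vrel V (ultra X) Y) FF G y :
  is_module r ->
  qle (qten (ultra_rel (conv X) FF G) (r G y)) (r (ultra_mult FF) y).
Proof. by move=> [rX _]; rewrite -{2}rX; exact: le_kcomp. Qed.

(** This is the module law over the one-point space, read at the principal ultrafilter of [t]. *)
Lemma module_qlim X (psi : vrel V (ultra X) (one_space V)) FF t :
  is_module psi -> qle (qlim FF (psi^~ t)) (psi (ultra_mult FF) t).
Proof.
move=> [_ psi1]; rewrite -{2}psi1.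
apply: qle_trans (le_kcomp _ _ FF (ultra_unit t) t).
rewrite ultra_rel_unitr -{1}[qlim _ _]qten1r; apply: qten_le_r.
exact: (conv_unit (X := one_space V)).
Qed.

Definition presheaf_ev X : vrel V (ultra X) (presheaf X) :=
  fun F psi => sval psi F tt.

(** The largest [c] with [kcomp c ev] below [ev], where [ev] is [presheaf_ev]. It is an explicit
    candidate for the structure of the exponential. *)
Definition presheaf_conv X : vrel V (ultra (presheaf X)) (presheaf X) :=
  fun P psi => qinf [set qres (ultra_rel (@presheaf_ev X) FF P)
    (presheaf_ev (ultra_mult FF) psi) | FF in setT].

Lemma presheaf_convP X P psi w :
  qle w (@presheaf_conv X P psi) <->
  forall FF, qle (qten (ultra_rel (@presheaf_ev X) FF P) w)
                 (presheaf_ev (ultra_mult FF) psi).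
Proof.
split=> [wc FF|H].
  by rewrite qtenC; apply/qresP; apply: qle_trans wc (qinf_lb _); exists FF.
by apply: qinf_greatest => _ [FF _ <-]; apply/qresP; rewrite qtenC.
Qed.

Lemma presheaf_conv_le X FF P psi :
  qle (qten (ultra_rel (@presheaf_ev X) FF P) (presheaf_conv P psi))
      (presheaf_ev (ultra_mult FF) psi).
Proof. by have /presheaf_convP := qle_refl (presheaf_conv P psi); exact. Qed.

(** The unit law is [module_qlim]. For associativity, [FF] is lifted along the multiplication and
    the defining inequality is applied twice, the first time under [ultra_rel]. *)
Lemma presheaf_str_exists X :
  {c : space_str V (presheaf X) | str_conv c = @presheaf_conv X}.
Proof.
apply: space_str_intro => [psi|PP P psi]; apply/presheaf_convP => FF.
  rewrite qten1r ultra_rel_unitr; exact: module_qlim (svalP psi).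
have [FFF <- le] := ultra_rel_mult_lift HV (@presheaf_ev X) FF PP.
rewrite qtenA ultra_multA; apply: qle_trans (presheaf_conv_le _ _ _).
apply: qten_le_l; apply: qle_trans (qten_le_l _ le) _.
rewrite -[P in X in qle _ X]ultra_map_id -ultra_rel_preimage.
apply: (ultra_rel_comp HV) => GG Q chi; exact: presheaf_conv_le.
Qed.

Lemma op_conv_mult X FF : qle (qone V) (op_conv (X := X) FF (ultra_mult FF)).
Proof.
apply: qle_trans (ultra_rel_unit_unitl (ultra_mult FF) (@conv_unit V X)) _.
rewrite -[ultra_rel _ _ _]qten1 /op_conv /rcomp /rconv /graph.
apply: qsup_ub; exists (ultra_map (@ultra_unit X) (ultra_mult FF)) => //.
by rewrite ultra_mult_map_unit asboolT.
Qed.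

Lemma op_conv_le X FF F (psi : presheaf X) :
  qle (qten (op_conv FF F) (presheaf_ev (ultra_mult FF) psi))
    (presheaf_ev F psi).
Proof.
rewrite qtenC /op_conv {1}/rcomp qten_sup.
apply: qsup_least => _ [_ [GG _ <-] <-].
rewrite /rconv /graph; case: asboolP => [<-|_].
  by rewrite qten1 qtenC; apply: module_conv (svalP psi).
by rewrite (qtenC (qsup set0)) !qten_bot; exact: bot_le.
Qed.

(** By [qconvP], being a map into [V] is an inequality about limits along ultrafilters on the
    product of [Z] and [ultra X]. These limits are exchanged with values of [ultra_rel] by
    [qlim_ultra_rel] and [ultra_rel_lift]. *)
Lemma presheaf_exponential X (c : space_str V (presheaf X)) :
  str_conv c = @presheaf_conv X -> exponential_str c.
Proof.
move=> cE Z h; rewrite cE.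
have ev_preimage FF F : ultra_rel (fun G z => presheaf_ev G (h z)) FF F =
    ultra_rel (@presheaf_ev X) FF (ultra_map h F).
  by rewrite -[FF in RHS]ultra_map_id -ultra_rel_preimage.
split=> [mh W [z F]|mh F z].
  apply/(qconvP HV); rewrite qlim_map /tensor_conv /=.
  have le1 := mh (ultra_map fst W) z.
  apply: qle_trans (op_conv_le (ultra_map snd W) F (h z)).
  rewrite -qtenA (qtenC (conv _ _ _)) -qtenA; apply: qten_le_r.
  apply: qle_trans (presheaf_conv_le _ (ultra_map h (ultra_map fst W)) _).
  apply: qten_mono => //; rewrite -ev_preimage.
  exact: (qlim_ultra_rel snd fst (fun G z => presheaf_ev G (h z))).
apply/presheaf_convP => FF; rewrite -ev_preimage.
have [W [<- <- ->]] := ultra_rel_lift HV (fun G z => presheaf_ev G (h z)) FF F.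
pose W' := ultra_map (fun p => (p.2, p.1)) W.
(* At this point of [ultra X] the factor coming from [op_conv] is the unit, by [op_conv_mult]. *)
have /(qconvP HV) := mh W' (z, ultra_mult (ultra_map fst W)).
rewrite qlim_map qlim_map /tensor_conv /=; apply: qle_trans.
rewrite qtenC; apply: qten_le_l.
rewrite -{1}[conv _ _ _]qten1r; apply: qten_mono; last exact: op_conv_mult.
by rewrite /W' ultra_map_comp; exact: qle_refl.
Qed.

(** The universal property, tested on the identity, makes any two exponential structures comparable
    in both directions; so the one chosen in [presheaf_str] is the explicit one. *)
Lemma conv_presheaf_space X : conv (presheaf_space X) = @presheaf_conv X.
Proof.
have [c cE] := presheaf_str_exists X; have ec := presheaf_exponential cE.
rewrite -cE /conv /presheaf_space /= /presheaf_str.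
case: pselect => [e|[]]; last by exists c.
case: (cid e) => c' ec' /=.
have to (c1 c2 : space_str V (presheaf X)) :
    exponential_str c1 -> exponential_str c2 -> rel_le c1 c2.
  move=> e1 e2 P psi; rewrite -[P in X in qle _ X]ultra_map_id.
  apply: (iffRL (e2 (Space c1) id)).
  apply: (iffLR (e1 (Space c1) id)) => F x.
  by rewrite ultra_map_id; exact: qle_refl.
by apply: rel_le_anti; exact: to.
Qed.

End Modules.

(** * The spaces of presheaves in the class *)

Section PhiSpaces.
Variable V : quantale.
Hypothesis HV : regular_quantale V.
Variable Phi : module_class V.
Implicit Types (A B X Y Z : space V).
Local Notation PS := (Phi_space Phi).

Definition ev X : vrel V (ultra X) (PS X) := fun F p => sval (sval p) F tt.

Definition uncurry X (B : Type) (d : B -> PS X) : vrel V (ultra X) B :=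
  fun F b => ev F (d b).

Lemma Phi_convP X P p w :
  qle w (conv (PS X) P p) <->
  forall FF, qle (qten (ultra_rel (@ev X) FF P) w) (ev (ultra_mult FF) p).
Proof.
have -> : conv (PS X) P p = presheaf_conv (ultra_map sval P) (sval p).
  by rewrite /conv (svalP (subspace_subproof _)) (conv_presheaf_space HV).
have E FF : ultra_rel (@ev X) FF P =
    ultra_rel (@presheaf_ev V X) FF (ultra_map sval P).
  by rewrite -[FF in RHS]ultra_map_id -ultra_rel_preimage.
by split=> [/presheaf_convP H FF|H];
  [rewrite E; exact: H|apply/presheaf_convP => FF; rewrite -E; exact: H].
Qed.

Lemma Phi_conv_le X FF P p :
  qle (qten (ultra_rel (@ev X) FF P) (conv (PS X) P p)) (ev (ultra_mult FF) p).
Proof. by have /Phi_convP := qle_refl (conv (PS X) P p); exact. Qed.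

Lemma ultra_rel_uncurry X (B : Type) (d : B -> PS X) FF G :
  ultra_rel (uncurry d) FF G = ultra_rel (@ev X) FF (ultra_map d G).
Proof. by rewrite -[FF in RHS]ultra_map_id -ultra_rel_preimage. Qed.

Lemma ev_inj X (p q : PS X) : (forall F, ev F p = ev F q) -> p = q.
Proof.
case: p q => -[r mr] cr [[s ms] cs] pq; apply: eq_exist; apply: eq_exist.
by apply/funext => F; apply/funext => -[]; exact: (pq F).
Qed.

Lemma uncurry_inj X (B : Type) (d e : B -> PS X) :
  uncurry d = uncurry e -> d = e.
Proof.
move=> de; apply/funext => b; apply: ev_inj => F.
exact: (congr1 (fun r => r F b) de).
Qed.

Lemma le_lower_star X B (d : B -> PS X) (gamma : vrel V (ultra B) (PS X)) :
  rel_le gamma (lower_star d) <-> rel_le (kcomp gamma (uncurry d)) (@ev X).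
Proof.
rewrite rel_le_kcomp; split=> [H FF G p|H G p].
  rewrite ultra_rel_uncurry; apply: qle_trans (Phi_conv_le _ _ _).
  exact: qten_le_r (H _ _).
by apply/Phi_convP => FF; rewrite -ultra_rel_uncurry; exact: H.
Qed.

Lemma le_upper_star X B (d : B -> PS X) (gamma : vrel V (ultra (PS X)) B) :
  rel_le gamma (upper_star d) <-> rel_le (kcomp gamma (@ev X)) (uncurry d).
Proof.
rewrite rel_le_kcomp; split=> [H FF G p|H G p].
  apply: qle_trans (qten_le_r _ (H _ _)) _; exact: Phi_conv_le.
by apply/Phi_convP => FF; exact: H.
Qed.

Lemma is_map_uncurry X B (d : B -> PS X) :
  is_map d <-> rel_le (kcomp (conv B) (uncurry d)) (uncurry d).
Proof.
rewrite rel_le_kcomp; split=> [md FF F b|H F b].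
  rewrite ultra_rel_uncurry; apply: qle_trans (qten_le_r _ (md _ _)) _.
  exact: Phi_conv_le.
by apply/Phi_convP => FF; rewrite -ultra_rel_uncurry; exact: H.
Qed.

Lemma kcomp_pt_star Y (X : Type) (r : vrel V (ultra X) Y) y :
  kcomp (pt_star y) r = fun F _ => kcomp (conv Y) r F y.
Proof. by []. Qed.

(** The rows of [uncurry d] are the points [d b], which lie in the class, so [class_pointwise]
    applies. *)
Lemma uncurry_class X B (d : B -> PS X) : is_map d -> in_class Phi (uncurry d).
Proof.
move=> /is_map_uncurry md; have mod : is_module (uncurry d).
  apply: is_module_le => //; apply/rel_le_kcomp => FF G b.
  exact: module_conv (svalP (sval (d b))).
apply/(class_pointwise _ mod) => b; rewrite kcomp_pt_star mod.2.
have -> : (fun F (_ : one_space V) => uncurry d F b) = sval (sval (d b)).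
  by apply/funext => F; apply/funext => -[].
exact: svalP (d b).
Qed.

Lemma row_class X B (r : vrel V (ultra X) B) b :
  in_class Phi r -> in_class Phi (kcomp (pt_star b) r).
Proof. by move=> rP; apply: (iffLR (class_pointwise _ (class_module rP))). Qed.

Definition curry X B (r : vrel V (ultra X) B) (rP : in_class Phi r) (b : B) :
    PS X :=
  exist _ (exist _ (kcomp (pt_star b) r) (class_module (row_class b rP)))
    (row_class b rP).

Lemma curryK X B (r : vrel V (ultra X) B) (rP : in_class Phi r) :
  uncurry (curry rP) = r.
Proof. by rewrite -[RHS](class_module rP).2. Qed.

Lemma curry_map X B (r : vrel V (ultra X) B) (rP : in_class Phi r) :
  is_map (curry rP).
Proof.
apply/is_map_uncurry; rewrite curryK (class_module rP).2; exact: rel_le_refl.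
Qed.

Lemma ev_class X : in_class Phi (@ev X).
Proof. exact: (uncurry_class (@is_map_id _ (PS X))). Qed.

Lemma uncurry_yoneda X : uncurry (@yoneda V Phi X) = conv X.
Proof. by []. Qed.

Lemma yoneda_map X : is_map (@yoneda V Phi X).
Proof.
by apply/is_map_uncurry; rewrite uncurry_yoneda (conv_module X).2;
  exact: rel_le_refl.
Qed.

(** The Yoneda lemma. Both inequalities are instances of [le_lower_star], as [yoneda] uncurries to
    the identity module. *)
Lemma lower_star_yoneda X : lower_star (@yoneda V Phi X) = @ev X.
Proof.
apply: rel_le_anti; last first.
  apply/le_lower_star; rewrite uncurry_yoneda (class_module (ev_class X)).1.
  exact: rel_le_refl.
apply: rel_le_trans (kcomp_conv_ge _) _.
by rewrite -uncurry_yoneda; apply/le_lower_star; exact: rel_le_refl.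
Qed.

Lemma Phi_pt_leP X (p q : PS X) :
  pt_le p q <-> forall F, qle (ev F p) (ev F q).
Proof.
rewrite /pt_le Phi_convP; split=> [H F|H FF].
  rewrite -(ultra_mult_unit F); apply: qle_trans (H (ultra_unit F)).
  by rewrite qten1r; rewrite ultra_mult_unit; exact: ultra_rel_principal.
rewrite qten1r ultra_rel_unitr; apply: qle_trans (H _).
exact: module_qlim (svalP (sval p)).
Qed.

Lemma Phi_T0 X : T0 (PS X).
Proof.
move=> p q /Phi_pt_leP pq /Phi_pt_leP qp; apply: ev_inj => F.
exact: qle_anti.
Qed.

Lemma map_le_uncurry X B (d e : B -> PS X) :
  map_le d e <-> rel_le (uncurry d) (uncurry e).
Proof.
split=> [de F b|de b]; last by apply/Phi_pt_leP => F; exact: de.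
exact: (iffLR (Phi_pt_leP _ _) (de b)).
Qed.

(* [psi |-> psi o phi]. *)
Definition precomp X Y (phi : vrel V (ultra X) Y) (phiP : in_class Phi phi) :
  PS Y -> PS X := curry (class_comp phiP (ev_class Y)).

Lemma precomp_map X Y (phi : vrel V (ultra X) Y) (phiP : in_class Phi phi) :
  is_map (precomp phiP).
Proof. exact: curry_map. Qed.

Lemma uncurry_precomp X Y B (phi : vrel V (ultra X) Y) (phiP : in_class Phi phi)
    (d : B -> PS Y) :
  uncurry (precomp phiP \o d) = kcomp (uncurry d) phi.
Proof.
have E := curryK (class_comp phiP (ev_class Y)).
by apply/funext => F; apply/funext => b; exact: (congr1 (fun r => r F (d b)) E).
Qed.

Lemma uncurry_precomp_id X Y (phi : vrel V (ultra X) Y)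
    (phiP : in_class Phi phi) :
  uncurry (precomp phiP) = kcomp (@ev Y) phi.
Proof. exact: curryK. Qed.

(** Precomposition is contravariant and monotone, so it turns the left adjoint [phi] into a right
    adjoint. *)
Lemma precomp_adjoint X Y (phi : vrel V (ultra X) Y)
    (theta : vrel V (ultra Y) X) (phiP : in_class Phi phi)
    (thetaP : in_class Phi theta) :
  rel_le (conv X) (kcomp theta phi) -> rel_le (kcomp phi theta) (conv Y) ->
  left_adjoint (precomp thetaP) (precomp phiP).
Proof.
move=> unit counit; split; try exact: precomp_map; apply/map_le_uncurry.
  rewrite uncurry_precomp uncurry_precomp_id -(kcompA HV).
  rewrite -[X in rel_le X _](class_module (ev_class X)).1.
  exact: kcomp_le_r.
rewrite uncurry_precomp uncurry_precomp_id -(kcompA HV).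
rewrite -[X in rel_le _ X](class_module (ev_class Y)).1.
exact: kcomp_le_r.
Qed.

Lemma colimitP X A B (d : B -> PS X) (psi : vrel V (ultra B) A)
    (g : A -> PS X) :
  is_map d -> in_class Phi psi ->
  is_colimit d psi g <-> uncurry g = kcomp psi (uncurry d).
Proof.
move=> md psiP.
have colim g' : uncurry g' = kcomp psi (uncurry d) -> is_colimit d psi g'.
  move=> gE; have mg : is_map g'.
    apply/is_map_uncurry; rewrite gE (kcompA HV) (class_module psiP).2.
    exact: rel_le_refl.
  have le gamma : rel_le (kcomp gamma psi) (lower_star d) <->
      rel_le gamma (lower_star g').
    by rewrite !le_lower_star gE (kcompA HV).
  split=> // [|gamma _ /le //]; exact/le/rel_le_refl.
split=> [[mg le gmax]|]; last exact: colim.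
(* The composite module always provides a colimit [g']; since the space is T0, any other colimit is
   equal to it. *)
pose g' := curry (class_comp (uncurry_class md) psiP).
have g'E : uncurry g' = kcomp psi (uncurry d) by exact: curryK.
have [mg' le' gmax'] := colim _ g'E; rewrite -g'E.
congr uncurry; apply: (lower_star_inj (@Phi_T0 X)); apply: rel_le_anti.
  by apply: gmax' le; exact: lower_star_module.
by apply: gmax le'; exact: lower_star_module.
Qed.

End PhiSpaces.

(** * Precomposition with modules *)

Section Duality.
Variable V : quantale.
Hypothesis HV : regular_quantale V.
Variable Phi : module_class V.
Implicit Types (A B X Y Z W : space V).
Local Notation PS := (Phi_space Phi).

(** Here [r'] is below [r' o s o r], which is below [r]. Used in both directions, this makes left
    adjoints of [s] unique. *)
Lemma adjoint_module_unique X Y (r r' : vrel V (ultra X) Y)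
    (s : vrel V (ultra Y) X) :
  is_module r -> is_module r' ->
  rel_le (conv X) (kcomp s r) -> rel_le (kcomp r' s) (conv Y) -> rel_le r' r.
Proof.
move=> [_ rY] [rX' _] unit counit; rewrite -[X in rel_le X _]rX' -rY.
apply: rel_le_trans (kcomp_le_r _ unit) _; rewrite (kcompA HV).
exact: kcomp_le_l.
Qed.

Lemma precomp_ext X Y (phi phi' : vrel V (ultra X) Y) (phiP : in_class Phi phi)
    (phiP' : in_class Phi phi') :
  phi = phi' -> precomp HV phiP = precomp HV phiP'.
Proof.
by move=> E; apply: uncurry_inj; rewrite !uncurry_precomp_id E.
Qed.

(** The supremum is precomposition with [ev], the lower star of [yoneda], and its left adjoint is
    precomposition with the upper star of [yoneda]. *)
Lemma Phi_distributive X : distributive Phi (PS X).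
Proof.
split; first exact: (Phi_T0 HV).
have yP := class_upper Phi (yoneda_map HV Phi (X := X)).
exists (precomp HV (ev_class HV Phi X)), (precomp HV yP); split; last first.
  by apply: precomp_adjoint; rewrite -(lower_star_yoneda HV);
    [apply: star_unit|apply: star_counit]; exact: yoneda_map.
split; [exact: precomp_map|exact: yoneda_map| |]; apply/(map_le_uncurry HV).
  apply: (iffRL (le_upper_star HV (precomp HV (ev_class HV Phi X)) _)).
  by rewrite uncurry_precomp_id; exact: rel_le_refl.
rewrite uncurry_precomp uncurry_yoneda (class_module (ev_class HV Phi X)).2.
exact: rel_le_refl.
Qed.

Lemma Phi_algebraic X : algebraic Phi (PS X).
Proof.
split; first exact: Phi_distributive.
by exists X, id, id; split=> //; exact: is_map_id.
Qed.

Lemma precomp_cocontinuous X Y (phi : vrel V (ultra X) Y)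
    (phiP : in_class Phi phi) :
  cocontinuous Phi (precomp HV phiP).
Proof.
move=> A B d psi g md psiP /(colimitP HV _ md psiP) gE.
apply/(colimitP HV) => //; first exact: is_map_comp md (precomp_map _ _).
by rewrite !uncurry_precomp gE (kcompA HV).
Qed.

Lemma precomp_algebraic X Y (f : X -> Y) (df : dense_map Phi f) :
  algebraic_map Phi (precomp HV df.2).
Proof.
split; [exact: precomp_map| |exact: precomp_cocontinuous].
exists (precomp HV (class_upper Phi df.1)).
by apply: precomp_adjoint; [apply: star_unit|apply: star_counit]; exact: df.1.
Qed.

Lemma precomp_dense_id X (df : dense_map Phi (X := X) id) :
  precomp HV df.2 = id.
Proof.
apply: uncurry_inj; rewrite uncurry_precomp_id.
have -> : lower_star (X := X) id = conv X.
  by apply/funext => F; rewrite /lower_star ultra_map_id.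
exact: (class_module (ev_class HV Phi X)).1.
Qed.

Lemma precomp_dense_comp X Y Z (f : X -> Y) (g : Y -> Z) (df : dense_map Phi f)
    (dg : dense_map Phi g) (dgf : dense_map Phi (g \o f)) :
  precomp HV dgf.2 = precomp HV df.2 \o precomp HV dg.2.
Proof.
apply: uncurry_inj; rewrite uncurry_precomp !uncurry_precomp_id -(kcompA HV).
by rewrite (lower_star_comp df.1 dg.1).
Qed.

(** Restriction along [yoneda] recovers the lower stars, which determine the maps. *)
Lemma precomp_dense_inj X Y (f g : X -> Y) (df : dense_map Phi f)
    (dg : dense_map Phi g) :
  T0 Y -> precomp HV df.2 = precomp HV dg.2 -> f = g.
Proof.
move=> Y0 /(congr1 (fun h => uncurry (h \o @yoneda V Phi Y))).
rewrite !uncurry_precomp uncurry_yoneda.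
rewrite (class_module df.2).2 (class_module dg.2).2.
exact: lower_star_inj.
Qed.

Lemma const_map X (x : X) : is_map (X := one_space V) (fun=> x).
Proof.
move=> F t; apply: qle_trans (qone_top _) _.
have -> : ultra_map (fun=> x) F = ultra_unit x; last exact: conv_unit.
apply/esym/ultra_sub_eq => A Ax.
by apply: filterS (@filterT _ (ultra_sets F) _).
Qed.

(* Every point of [PS Y] is the colimit of [yoneda] weighted by itself, so that
   a cocontinuous map is determined by its restriction along [yoneda]. *)
Lemma cocontinuous_uncurry X Y (h : PS Y -> PS X) :
  is_map h -> cocontinuous Phi h ->
  uncurry h = kcomp (@ev V Phi Y) (uncurry (h \o @yoneda V Phi Y)).
Proof.
move=> mh ch; have my := yoneda_map HV Phi (X := Y).
apply/funext => F; apply/funext => p.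
have pP : in_class Phi (uncurry (fun _ : one_space V => p)).
  exact: (uncurry_class HV (const_map p)).
have /(ch _ _ _ _ _ my pP) : is_colimit (@yoneda V Phi Y)
    (uncurry (fun _ : one_space V => p)) (fun=> p).
  by apply/(colimitP HV) => //; rewrite uncurry_yoneda (class_module pP).1.
move=> /(colimitP HV _ (is_map_comp my mh) pP) E.
exact: (congr1 (fun r => r F tt) E).
Qed.

(** The half of cocontinuity that holds for every map; it is applied to the left adjoint in
    [sober_full]. *)
Lemma uncurry_map_ge X Y (l : PS X -> PS Y) : is_map l ->
  rel_le (kcomp (@ev V Phi X) (uncurry (l \o @yoneda V Phi X))) (uncurry l).
Proof.
move=> ml; have le : rel_le (@ev V Phi X)
    (fun F p => lower_star (l \o @yoneda V Phi X) F (l p)).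
  move=> F p; rewrite -(lower_star_yoneda HV) /lower_star -ultra_map_comp.
  exact: ml.
apply: rel_le_trans (kcomp_le_l _ le) _ => F p.
exact: (iffLR (le_lower_star HV (l \o @yoneda V Phi X) _)
  (@rel_le_refl _ _ _ _) F (l p)).
Qed.

(** The restrictions [phi] of [h] and [theta] of [l] along [yoneda] are adjoint modules: their unit
    and counit are those of [l] and [h] at representable points. Sobriety then represents [phi] by a
    map. *)
Lemma sober_full X Y (h : PS Y -> PS X) : sober Phi Y -> algebraic_map Phi h ->
  exists (f : X -> Y) (df : dense_map Phi f), precomp HV df.2 = h.
Proof.
move=> [_ soberY] [mh [l [ml _ unit counit]] ch].
have my Z := yoneda_map HV Phi (X := Z).
pose phi := uncurry (h \o @yoneda V Phi Y).
pose theta := uncurry (l \o @yoneda V Phi X).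
have phiP : in_class Phi phi by apply: uncurry_class => //; exact: is_map_comp.
have thetaP : in_class Phi theta.
  by apply: uncurry_class => //; exact: is_map_comp.
have hE := cocontinuous_uncurry mh ch.
have hdE (B : Type) (d : B -> PS Y) : uncurry (h \o d) = kcomp (uncurry d) phi.
  apply/funext => F; apply/funext => b.
  exact: (congr1 (fun r => r F (d b)) hE).
have [|f [[mf fE] _]] := soberY X phi.
  split=> //; exists theta; split=> //.
    rewrite -hdE -(uncurry_yoneda Phi X); apply/(map_le_uncurry HV) => x.
    exact: unit.
  rewrite /phi hdE uncurry_yoneda (class_module phiP).2.
  have le : rel_le (kcomp (uncurry (h \o @yoneda V Phi Y)) theta)
      (uncurry (l \o (h \o @yoneda V Phi Y))).
    move=> F y; exact: (uncurry_map_ge ml).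
  apply: rel_le_trans le _; rewrite -(uncurry_yoneda Phi Y).
  apply/(map_le_uncurry HV) => y; exact: counit.
have df : dense_map Phi f by split; rewrite -?fE.
exists f, df; apply: uncurry_inj; rewrite uncurry_precomp_id hE.
by rewrite -fE.
Qed.

Lemma iso_conv X Y (f : X -> Y) (g : Y -> X) :
  is_map f -> is_map g -> cancel f g -> cancel g f ->
  forall F y, conv Y (ultra_map f F) y = conv X F (g y).
Proof.
move=> mf mg fK gK F y; apply: qle_anti.
  apply: qle_trans (mg _ _) _; rewrite ultra_map_comp.
  have -> : g \o f = id by apply/funext.
  by rewrite ultra_map_id; exact: qle_refl.
by apply: qle_trans (mf _ _) _; rewrite gK; exact: qle_refl.
Qed.

Lemma iso_algebraic_map X Y (f : X -> Y) (g : Y -> X) :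
  is_map f -> is_map g -> cancel f g -> cancel g f -> algebraic_map Phi f.
Proof.
move=> mf mg fK gK; split=> //.
  exists g; split=> // x /=; rewrite ?fK ?gK; exact: conv_unit.
have starE B (k : B -> X) :
    lower_star (f \o k) = fun F y => lower_star k F (g y).
  apply/funext => F; apply/funext => y.
  by rewrite /lower_star -ultra_map_comp (iso_conv mf mg).
move=> A B d psi k md psiP [mk le kmax]; split; first exact: is_map_comp.
  by rewrite !starE => F y; exact: le.
move=> gamma gammaM gamma_le; rewrite starE => F y.
(* Maximality of [k] is tested on [gamma] reindexed along [f]; this is [kcomp (upper_star f) gamma],
   hence a module. *)
rewrite -{1}[y]gK; apply: (kmax (fun F x => gamma F (f x))).
  rewrite -(upper_star_kcomp f gammaM); split.
    by rewrite -(kcompA HV) gammaM.1.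
  by rewrite (kcompA HV) (class_module (class_upper Phi mf)).2.
move=> G x; apply: qle_trans (gamma_le G (f x)) _.
by rewrite starE fK; exact: qle_refl.
Qed.

End Duality.

(** * Sobrification *)

Section Sobrification.
Variable V : quantale.
Hypothesis HV : regular_quantale V.
Variable Phi : module_class V.
Implicit Types (X Y W : space V).
Local Notation PS := (Phi_space Phi).
Variable Z : space V.

Lemma conv_subspace X (P : X -> Prop) F x :
  conv (subspace P) F x = conv X (ultra_map sval F) (sval x).
Proof. by rewrite /conv (svalP (subspace_subproof _)). Qed.

Lemma sval_map X (P : X -> Prop) : is_map (X := subspace P) (Y := X) sval.
Proof. by move=> F x; rewrite conv_subspace; exact: qle_refl. Qed.

Lemma is_map_subspace X Y (P : X -> Prop) (f : Y -> subspace P) :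
  is_map (sval \o f : Y -> X) -> is_map f.
Proof.
by move=> mf F y; rewrite conv_subspace ultra_map_comp; exact: mf.
Qed.

Lemma T0_subspace X (P : X -> Prop) : T0 X -> T0 (subspace P).
Proof.
move=> X0 x y; rewrite /pt_le !conv_subspace !ultra_map_unit => xy yx.
apply: eq_sig_hprop => [? ? ?|]; [exact: Prop_irrelevance|exact: X0].
Qed.

Let y := yoneda Phi (X := Z).
Let y_map : is_map y := yoneda_map HV Phi (X := Z).

(* The points at which the left adjoint [psi |-> psi o y^*] of [Sup] agrees with
   the Yoneda embedding of [PS Z]; the reverse inequality always holds. *)
Definition prime_point (p : PS Z) : Prop :=
  forall F, qle (conv (PS Z) F p) (kcomp (@ev V Phi Z) (upper_star y) F p).

Definition sobrification : space V := subspace prime_point.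
Local Notation A := sobrification.

Lemma kcomp_uncurry X (B : Type) (d : B -> PS X) Y (r : vrel V (ultra Y) X)
    F b :
  kcomp (uncurry d) r F b = kcomp (@ev V Phi X) r F (d b).
Proof. by []. Qed.

Lemma yoneda_prime z : prime_point (y z).
Proof.
move=> F; rewrite -kcomp_uncurry uncurry_yoneda.
rewrite (class_module (class_upper Phi y_map)).2; exact: qle_refl.
Qed.

Definition sober_unit (z : Z) : A := exist _ (y z) (yoneda_prime z).

Lemma sober_unit_map : is_map sober_unit.
Proof. by apply: is_map_subspace; exact: y_map. Qed.

Let i : A -> PS Z := sval.
Let i_map : is_map i := @sval_map _ _.

(** By [lower_star_sober_unit], [I] and [J] are the two stars of [sober_unit]; they turn out to be
    inverse modules. *)
Let I := uncurry i.
Let J := upper_star sober_unit.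

Let IP : in_class Phi I := uncurry_class HV i_map.
Let JP : in_class Phi J := class_upper Phi sober_unit_map.

Lemma lower_star_sober_unit : lower_star sober_unit = I.
Proof.
apply/funext => F; apply/funext => a.
rewrite /lower_star conv_subspace ultra_map_comp.
exact: (congr1 (fun r => r F (sval a)) (lower_star_yoneda HV Phi Z)).
Qed.

Lemma kcomp_upper_star_i X (r : vrel V (ultra Z) X) F x : in_class Phi r ->
  kcomp r (upper_star y) (ultra_map i F) x = kcomp r J F x.
Proof.
move=> rP; have yP := class_upper Phi y_map.
have mod := class_module (class_comp yP rP).
have -> : kcomp r (upper_star y) (ultra_map i F) x =
    kcomp (kcomp r (upper_star y)) (lower_star i) F x.
  by rewrite (kcomp_lower_star i_map mod).
rewrite -(kcompA HV) (kcomp_lower_star i_map (class_module yP)).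
congr (kcomp r _ F x); apply/funext => G; apply/funext => z.
by rewrite /J /upper_star [RHS]conv_subspace.
Qed.

(** One inequality is the counit of an adjunction; the other is exactly primeness of the points of
    [A]. *)
Lemma sober_IJ : kcomp I J = conv A.
Proof.
apply: rel_le_anti.
  by rewrite -lower_star_sober_unit; apply: star_counit; exact: sober_unit_map.
move=> F a; rewrite conv_subspace; apply: qle_trans (svalP a _) _.
rewrite (kcomp_upper_star_i _ _ (ev_class HV Phi Z)); exact: qle_refl.
Qed.

Lemma sober_JI : kcomp J I = conv Z.
Proof. by rewrite (upper_star_kcomp _ (class_module IP)). Qed.

Lemma sobrification_iso : isomorphic (PS Z) (PS A).
Proof.
have evM X := class_module (ev_class HV Phi X).
have IJ : precomp HV IP \o precomp HV JP = id.
  apply: uncurry_inj; rewrite uncurry_precomp uncurry_precomp_id -(kcompA HV).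
  by rewrite sober_JI (evM _).1.
have JI : precomp HV JP \o precomp HV IP = id.
  apply: uncurry_inj; rewrite uncurry_precomp uncurry_precomp_id -(kcompA HV).
  by rewrite sober_IJ (evM _).1.
exists (precomp HV JP), (precomp HV IP).
split; try exact: precomp_map; move=> p.
  exact: (congr1 (fun h => h p) IJ).
exact: (congr1 (fun h => h p) JI).
Qed.

Section AdjointModule.
Variables (W : space V) (r : vrel V (ultra W) A) (s : vrel V (ultra A) W).
Hypotheses (rP : in_class Phi r) (sP : in_class Phi s).
Hypotheses (unit : rel_le (conv W) (kcomp s r)).
Hypotheses (counit : rel_le (kcomp r s) (conv A)).

(** A map [f] with lower star [r] must have upper star [s], so [f0] sends [w] to the row of [s] at
    [w], transported to [Z] along [I]. *)
Let th := kcomp s I.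
Let thP : in_class Phi th := class_comp IP sP.
Let f0 : W -> PS Z := curry thP.
Let f0_map : is_map f0 := curry_map HV thP.

(** This equation makes the points [f0 w] prime. The inequality from left to right uses that
    [kcomp J r] is left adjoint to [th]: the unit inserts [th o J o r], and the counit bounds
    [J o r o th] by the identity of [Z]. *)
Lemma upper_star_f0 : upper_star f0 = kcomp th (upper_star y).
Proof.
have yP := class_upper Phi y_map; have f0P := class_upper Phi f0_map.
have evM := class_module (ev_class HV Phi Z).
have f0ev : kcomp (upper_star f0) (@ev V Phi Z) = th.
  by rewrite (upper_star_kcomp _ evM) -[RHS](curryK thP).
have yev : kcomp (upper_star y) (@ev V Phi Z) = conv Z.
  by rewrite (upper_star_kcomp _ evM).
apply: rel_le_anti; last first.
  apply/(le_upper_star HV); rewrite -(kcompA HV) yev (class_module thP).1.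
  by rewrite curryK; exact: rel_le_refl.
have unit' : rel_le (conv W) (kcomp th (kcomp J r)).
  rewrite (kcompA HV) /th -[kcomp (kcomp s I) J](kcompA HV) sober_IJ.
  by rewrite (class_module sP).1.
rewrite -[X in rel_le X _](class_module f0P).2.
apply: rel_le_trans (kcomp_le_l _ unit') _; rewrite -(kcompA HV).
apply: kcomp_le_r; apply/(le_upper_star HV); rewrite uncurry_yoneda.
rewrite -(kcompA HV) f0ev /th (kcompA HV) -[kcomp (kcomp J r) s](kcompA HV).
apply: rel_le_trans (kcomp_le_l _ (kcomp_le_r _ counit)) _.
by rewrite (class_module JP).1 sober_JI; exact: rel_le_refl.
Qed.

Lemma f0_prime w : prime_point (f0 w).
Proof.
move=> F; rewrite -kcomp_uncurry curryK -upper_star_f0; exact: qle_refl.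
Qed.

Let f (w : W) : A := exist _ (f0 w) (f0_prime w).

(** The upper star of [f] is [s], so [r] and the lower star of [f] are left adjoint to the same
    module. *)
Lemma adjoint_module_map : exists g : W -> A, is_map g /\ r = lower_star g.
Proof.
have f_map : is_map f by apply: is_map_subspace; exact: f0_map.
have sE : upper_star f = s.
  apply/funext => F; apply/funext => w.
  rewrite /upper_star conv_subspace -[LHS]/(upper_star f0 (ultra_map i F) w).
  rewrite upper_star_f0 (kcomp_upper_star_i _ _ thP) /th -(kcompA HV) sober_IJ.
  by rewrite (class_module sP).1.
exists f; split=> //; apply: rel_le_anti.
  apply: (adjoint_module_unique HV (lower_star_module f_map) (class_module rP)
    _ counit).
  by rewrite -sE; exact: star_unit.
apply: (adjoint_module_unique HV (class_module rP) (lower_star_module f_map)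
  unit).
by rewrite -sE; exact: star_counit.
Qed.

End AdjointModule.

Lemma sobrification_sober : sober Phi A.
Proof.
have A0 : T0 A by apply: T0_subspace; exact: (Phi_T0 HV).
split=> // W r [rP [s [sP unit counit]]].
have [f [mf rE]] := adjoint_module_map rP sP unit counit.
exists f; split=> // g [_ gE]; apply: (lower_star_inj A0).
by rewrite -rE.
Qed.

End Sobrification.

Lemma isomorphic_trans (V : quantale) (X Y Z : space V) :
  isomorphic X Y -> isomorphic Y Z -> isomorphic X Z.
Proof.
move=> [f [g [mf mg fK gK]]] [h [k [mh mk hK kK]]].
exists (h \o f), (g \o k); split; try exact: is_map_comp.
  exact: can_comp.
exact: can_comp.
Qed.

(** * The dual equivalence *)

Lemma equivalent_of_fully_faithful (C D : category) (F : functor C D) :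
  (forall X Y (g : hom (F X) (F Y)), exists f, fhom F f = g) ->
  (forall X Y (f g : hom X Y), fhom F f = fhom F g -> f = g) ->
  (forall Y : D, exists (X : C) (t : hom (F X) Y) (s : hom Y (F X)),
     comp t s = idm _ /\ comp s t = idm _) ->
  equivalent C D.
Proof.
move=> full faithful ess.
pose lft X Y (g : hom (F X) (F Y)) := sval (cid (full X Y g)).
have lftK X Y (g : hom (F X) (F Y)) : fhom F (lft _ _ g) = g.
  exact: svalP (cid (full X Y g)).
pose G0 Y := sval (cid (ess Y)).
have ess1 Y := svalP (cid (ess Y)).
pose t Y : hom (F (G0 Y)) Y := sval (cid (ess1 Y)).
have ess2 Y := svalP (cid (ess1 Y)).
pose s Y : hom Y (F (G0 Y)) := sval (cid (ess2 Y)).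
have ts Y : comp (t Y) (s Y) = idm _ by have [] := svalP (cid (ess2 Y)).
have st Y : comp (s Y) (t Y) = idm _ by have [] := svalP (cid (ess2 Y)).
pose G1 X Y (g : hom X Y) := lft _ _ (comp (t X) (comp g (s Y))).
have G1K X Y (g : hom X Y) : fhom F (G1 _ _ g) = comp (t X) (comp g (s Y)).
  exact: lftK.
have G_id X : G1 X X (idm X) = idm (G0 X).
  by apply: faithful; rewrite G1K fhom_id comp_idl ts.
have G_comp X Y Z (f : hom X Y) (g : hom Y Z) :
    G1 _ _ (comp f g) = comp (G1 _ _ f) (G1 _ _ g).
  apply: faithful; rewrite fhom_comp !G1K !compA.
  by rewrite -[comp (comp _ (s Y)) (t Y)]compA st comp_idr.
pose G := @Functor D C G0 G1 G_id G_comp.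
exists F, G; split.
  exists (fun X => lft _ _ (t (F X))), (fun X => lft _ _ (s (F X))).
  split=> [X Y f|X|X]; apply: faithful.
  - by rewrite !fhom_comp !lftK /= -!compA st comp_idr.
  - by rewrite fhom_comp !lftK ts fhom_id.
  - by rewrite fhom_comp !lftK st fhom_id.
exists t, s; split=> // X Y f /=.
by rewrite G1K -!compA st comp_idr.
Qed.

Section DualEquivalence.
Variable V : quantale.
Hypothesis HV : regular_quantale V.
Variable Phi : module_class V.

Definition Phi_fobj (X : Sob Phi) : opposite (Alg Phi) :=
  exist _ (Phi_space Phi (sval X)) (Phi_algebraic HV Phi (sval X)).

Definition Phi_fhom (X Y : Sob Phi) (f : hom X Y) :
    hom (Phi_fobj X) (Phi_fobj Y) :=
  exist _ (precomp HV (svalP f).2) (precomp_algebraic HV (svalP f)).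

Lemma Phi_fhom_id X : Phi_fhom (idm X) = idm (Phi_fobj X).
Proof. by apply: eq_exist; exact: precomp_dense_id. Qed.

Lemma Phi_fhom_comp X Y Z (f : hom X Y) (g : hom Y Z) :
  Phi_fhom (comp f g) = comp (Phi_fhom f) (Phi_fhom g).
Proof. by apply: eq_exist; exact: precomp_dense_comp. Qed.

Definition Phi_functor : functor (Sob Phi) (opposite (Alg Phi)) :=
  Functor Phi_fhom_id Phi_fhom_comp.

Lemma Sob_Alg_dually_equivalent : dually_equivalent (Sob Phi) (Alg Phi).
Proof.
apply: (@equivalent_of_fully_faithful _ _ Phi_functor).
- move=> [X sX] [Y sY] [h ah].
  have [f [df fE]] := sober_full HV sY ah.
  by exists (exist _ f df); apply: eq_exist; rewrite -fE; exact: precomp_ext.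
- move=> [X sX] [Y sY] [f df] [g dg] /(congr1 sval) E.
  apply: eq_exist; exact: (precomp_dense_inj (HV := HV) sY.1 E).
- move=> [X [dX [Z XZ]]].
  have [f [g [mf mg fK gK]]] :=
    isomorphic_trans XZ (sobrification_iso HV Phi Z).
  exists (exist _ (sobrification Phi Z) (sobrification_sober HV Phi Z)).
  exists (exist _ f (iso_algebraic_map HV Phi mf mg fK gK)).
  exists (exist _ g (iso_algebraic_map HV Phi mg mf gK fK)).
  by split; apply: eq_exist; apply/funext => x /=; rewrite ?fK ?gK.
Qed.

End DualEquivalence.

(** * Regularity of the two quantales *)

Lemma bool_quantale_regular : regular_quantale bool_quantale.
Proof.
split.
- by case=> [] []; [left|right|left|left].
- move=> [] w H; last by [].
  by apply: H => S /implyP/(_ isT)/asboolP[s Ss s1]; exists s.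
- move=> u S [s Ss]; apply/implyP => /asboolP H.
  have /andP[u1 _] : u && s by apply: H; exists s.
  rewrite /= u1; apply/asboolP => v Sv.
  by have /andP[] : u && v by apply: H; exists v.
- move=> F u w.
  have limE : qlim (V := bool_quantale) F id = `[< F [set true] >].
    apply/idP/asboolP => [lim1|F1].
      apply: ultra_capture => F0.
      have : qle (qlim (V := bool_quantale) F id) (false : bool_quantale).
        by apply: (qlim_le F0) => -[] // /(_ erefl).
      by rewrite lim1.
    have /implyP : qle (true : bool_quantale) (qlim (V := bool_quantale) F id).
      by apply: qlim_ge; apply: filterS F1 => _ ->.
    exact.
  rewrite limE /=; case: w => //=; case: u; rewrite ?implybT //=.
    split=> // _; apply/asboolP => O [->|->|->] // _; exact: filterT.
  (* What remains is [w = true] and [u = false]: the open sets around [false] are [[set false]] and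
     the whole space, so convergence to [false] means that [[set true]] is not in [F]. *)
  rewrite implybF; split=> [/asboolP F0|/negP F1]; last first.
    apply/asboolP => O [->|->|->] // _; last exact: filterT.
    apply: ultra_capture => FC; apply: F1; apply/asboolP.
    by apply: filterS FC => -[] // /(_ erefl).
  apply/negP => /asboolP F1.
  have F2 : F [set false] by apply: F0 => //; apply: Or32.
  by have [x [-> ]] := ultra_nonempty (filterI F1 F2).
Qed.

Section ApproachRegular.
Variable R : realType.
Local Open Scope ereal_scope.

Lemma approach_quantale_regular : regular_quantale (approach_quantale R).
Proof.
split.
- move=> u v /=; case: (leP (sval v) (sval u)) => [|/ltW]; by [left|right].
- move=> u w H /=; have [->|uy] := eqVneq (sval u) +oo; first exact: leey.
  have ufin : sval u \is a fin_num by rewrite ge0_fin_numE ?ltey // (svalP u).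
  apply/lee_addgt0Pr => e e0.
  have e0' : (0 <= e%:E)%E by rewrite lee_fin ltW.
  (* For finite [u] and positive [e], the number [u + e] is totally below [u], since an infimum at
     most [u] has a term less than [u + e]. *)
  apply: (H (nn_add u (nn e0'))) => S /= Su.
  have [|_ [s Ss <-] su] := @ereal_inf_lt R (sval @` S) (sval u + e%:E).
    by apply: le_lt_trans Su _; rewrite lteDl // lte_fin.
  by exists s => //=; exact: ltW.
- move=> u S [s Ss] /=.
  set M := (X in _ <= X).
  have uM v : S v -> sval u + sval v <= M.
    move=> Sv; rewrite le_max; apply/orP; right; apply: ereal_sup_ubound.
    by exists (nn_add u v) => //; exists v.
  have M0 : 0 <= M by rewrite le_max lexx.
  clearbody M; case: (sval u) (svalP u) uM => [r| |] // r0 uM; last first.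
    apply: le_trans (uM _ Ss); rewrite [X in _ <= X]addye ?leey // -ltNye.
    have s0 : 0 <= sval s := svalP s; by rewrite (lt_le_trans _ s0) ?ltNy0.
  (* The comparison with 0 comes from the truncation in [nn_sup]; it is settled by the element [s]
     of [S]. *)
  rewrite addeC -leeBrDr // ge_max leeBrDr // add0e; apply/andP; split.
    by apply: le_trans (uM _ Ss); rewrite leeDl // (svalP s).
  by apply: ge_ereal_sup => _ [v Sv <-]; rewrite leeBrDr // addeC; exact: uM.
- move=> F u w.
  have -> : qlim (V := approach_quantale R) F id = nn_xi F.
    by congr nn_sup; apply: eq_imagel => A _; rewrite image_id.
  change (maxe (sval u - sval (nn_xi F)) 0 <= sval w <->
    sval u <= sval w + sval (nn_xi F)).
  (* If the limit is [+oo], both sides hold: the truncated difference is 0 and the sum is [+oo]. *)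
  have := svalP (nn_xi F); case: (sval (nn_xi F)) => [r| |] // r0.
    by rewrite ge_max (svalP w) andbT leeBlDr.
  rewrite addeNy ge_max leNye (svalP w) addey ?leey //.
  by rewrite -ltNye (lt_le_trans _ (svalP w)) ?ltNy0.
Qed.

End ApproachRegular.

Theorem theorem9p13 :
  (forall Phi : module_class bool_quantale,
     dually_equivalent (Sob Phi) (Alg Phi)) /\
  (forall (R : realType) (Phi : module_class (approach_quantale R)),
     dually_equivalent (Sob Phi) (Alg Phi)).
Proof.
split=> [|R] Phi; apply: Sob_Alg_dually_equivalent.
  exact: bool_quantale_regular.
exact: approach_quantale_regular.
Qed.
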